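(* Let $\Gamma$ be a non-elementary hyperbolic group, let $S$ be a finite generating set of $\Gamma$ and let $\nu_S$ be a Patterson–Sullivan measure for the word metric $d_S$ on the Gromov boundary $\partial\Gamma$. Then there exists $D>0$ such that for $\nu_S$-almost every $\xi\in\partial\Gamma$ there exists a $D$-rough geodesic ray $(\xi_k)_{k=0}^\infty$ for $d_S$ starting at the identity of $\Gamma$ with end point $\xi$ such that both of the following hold. (1) For every integer $N\ge1$ the set $\{[\xi_k]:k\ge N\}$ is spectrally rigid for $\overline{\mathcal D}_\Gamma$. (2) For every function $f:\mathbb{R}_{>0}\to\mathbb{R}_{>0}$ with $f(T)\to\infty$ as $T\to\infty$ there exists a subsequence $n_k$ such that $E=\{[\xi_{n_k}]:k\ge1\}$ is spectrally rigid for $\overline{\mathcal D}_\Gamma$ and $$\#\{[x]\in E:\ell_S[x]<T\}\le f(T)\quad\text{for all }T>0.$$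
   Context: $o$ denotes the identity of $\Gamma$, $\mathrm{conj}(\Gamma)$ the set of conjugacy classes, $[x]$ the class of $x$. Non-elementary: no cyclic subgroup of finite index. $d_S(x,y)$ is the minimal $k\ge0$ with $x^{-1}y=s_1\cdots s_k$, $s_i\in S\cup S^{-1}$. For a left-invariant (pseudo-)metric $d$ on $\Gamma$, the Gromov product is $(x,y)_{o,d}=\frac12(d(o,x)+d(o,y)-d(x,y))$ and the translation length function (marked length spectrum) is $\ell_d[x]=\lim_{n\to\infty}d(o,x^n)/n$; $\ell_S=\ell_{d_S}$. $\mathcal D_\Gamma$ is the set of left-invariant, Gromov hyperbolic metrics on $\Gamma$ that are quasi-isometric to a word metric (i.e. $L^{-1}d_S-C\le d\le L d_S+C$ for some $L>1$, $C\ge0$). $\overline{\mathcal D}_\Gamma$ is the set of left-invariant pseudo-metrics $d$ on $\Gamma$ with non-constant translation length function for which there exist $\lambda>0$ and $d_0\in\mathcal D_\Gamma$ with $(x,y)_{o,d}\le\lambda (x,y)_{o,d_0}+\lambda$ for all $x,y\in\Gamma$. Two (pseudo-)metrics $d,d_\ast$ are roughly similar if there are $\tau,C>0$ with $|\tau d(o,x)-d_\ast(o,x)|<C$ for all $x\in\Gamma$. A set $E\subset\mathrm{conj}(\Gamma)$ is spectrally rigid for $\overline{\mathcal D}_\Gamma$ if whenever $d,d_\ast\in\overline{\mathcal D}_\Gamma$ satisfy $\ell_d[x]=\ell_{d_\ast}[x]$ for all $[x]\in E$, then $d,d_\ast$ are roughly similar. A $D$-rough geodesic ray for $d_S$ is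 a sequence $(x_n)_{n\ge0}$ in $\Gamma$ with $|m-n|-D\le d_S(x_n,x_m)\le|m-n|+D$ for all $m,n$; its end point is its limit in $\partial\Gamma$. Patterson–Sullivan measure: let $v_S=\limsup_{T\to\infty}\frac1T\log\#\{x:d_S(o,x)<T\}$ and $\beta_o(x,\xi)=\sup\{\limsup_n(d_S(x,\xi_n)-d_S(o,\xi_n))\}$, supremum over sequences $(\xi_n)$ in $\Gamma$ converging to $\xi\in\partial\Gamma$. A Patterson–Sullivan measure for $d_S$ is a Borel probability measure $\nu$ on $\partial\Gamma$ for which there is $C>1$ with $C^{-1}e^{-v_S\beta_o(x,\xi)}\le\frac{dx_\ast\nu}{d\nu}(\xi)\le Ce^{-v_S\beta_o(x,\xi)}$ for all $x\in\Gamma$ and $\nu$-a.e. $\xi$. *)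

(* Defs.v *)
(* (Pseudo-)metrics on the group are functions G -> G -> R; conjugacy classes are
   sets, so subsets of conj(G) have type set (set G). *)
From HB Require Import structures.
From mathcomp Require Import all_boot all_order all_algebra finmap.
From mathcomp Require Import all_classical all_reals all_analysis.

Set Implicit Arguments.
Unset Strict Implicit.
Unset Printing Implicit Defensive.

Import Order.TTheory GRing.Theory Num.Theory numFieldNormedType.Exports.

Local Open Scope classical_set_scope.
Local Open Scope ring_scope.

Section Metrics.
Context {R : realType} {G : groupType}.
Implicit Types (d : G -> G -> R) (x y z w : G) (S : set G) (E : set (set G)).

Definition pseudo_metric d : Prop :=
  [/\ forall x, d x x = 0, forall x y, 0 <= d x y, forall x y, d x y = d y x
    & forall x y z, d x z <= d x y + d y z].

Definition metric d : Prop :=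
  pseudo_metric d /\ forall x y, d x y = 0 -> x = y.

Definition left_invariant d : Prop :=
  forall g x y, d (g * x)%g (g * y)%g = d x y.

(* gromov_product d w x y is (x, y)_{w, d} *)
Definition gromov_product d w x y : R := (d w x + d w y - d x y) / 2.

Definition gromov_hyperbolic d : Prop :=
  exists2 delta : R, 0 <= delta &
    forall w x y z,
      Num.min (gromov_product d w x y) (gromov_product d w y z) - delta
        <= gromov_product d w x z.

Definition conj_class x : set G := [set (x ^ g)%g | g in [set: G]].

Definition trans_length d x : R := limn (fun n => d 1%g (x ^+ n)%g / n%:R).

Definition is_word S (k : nat) x : Prop :=
  exists w : k.-tuple G,
    (forall s, s \in w -> S s \/ S s^-1%g) /\ x = (\prod_(s <- w) s)%g.

Definition generates S : Prop := forall x, exists k, is_word S k x.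

(* the minimal k such that x^-1 y is a word of length k in S and its inverses
   (0 by default if there is none, which does not happen if S generates) *)
Definition word_dist S x y : R :=
  (xget 0%N [set k | is_word S k (x^-1 * y)%g /\
                     forall j, is_word S j (x^-1 * y)%g -> (k <= j)%N])%:R.

Definition quasi_isometric d d' : Prop :=
  exists L C : R, [/\ 1 < L, 0 <= C &
    forall x y, L^-1 * d' x y - C <= d x y <= L * d' x y + C].

Definition in_D d : Prop :=
  [/\ metric d, left_invariant d, gromov_hyperbolic d &
    exists S, [/\ finite_set S, generates S & quasi_isometric d (word_dist S)]].

Definition in_Dbar d : Prop :=
  [/\ pseudo_metric d, left_invariant d,
    exists x y, trans_length d x <> trans_length d y &
    exists (lambda : R) (d0 : G -> G -> R), [/\ 0 < lambda, in_D d0 &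
      forall x y, gromov_product d 1%g x y
                    <= lambda * gromov_product d0 1%g x y + lambda]].

Definition roughly_similar d d' : Prop :=
  exists tau C : R, [/\ 0 < tau, 0 < C &
    forall x, `|tau * d 1%g x - d' 1%g x| < C].

Definition rough_geodesic_ray d (D : R) (xi : nat -> G) : Prop :=
  forall m n : nat,
    `|m%:R - n%:R| - D <= d (xi n) (xi m) <= `|m%:R - n%:R| + D.

(* limsup, as the real T tends to +oo, of (1/T) log #{x : d(o,x) < T} *)
Definition growth_rate d : \bar R :=
  limf_esup (fun T : R =>
    (T^-1 * ln (#|` fset_set [set x | d 1%g x < T] |)%:R)%:E) +oo%R.

End Metrics.

Definition spectrally_rigid (R : realType) (G : groupType)
    (E : set (set G)) : Prop :=
  forall d d' : G -> G -> R, in_Dbar d -> in_Dbar d' ->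
    (forall x, E (conj_class x) -> trans_length d x = trans_length d' x) ->
    roughly_similar d d'.

(* a group is a hyperbolic group if it has a finite generating set whose word
   metric is Gromov hyperbolic *)
Definition hyperbolic_group (R : realType) (G : groupType) : Prop :=
  exists S : set G, [/\ finite_set S, generates S &
    gromov_hyperbolic (word_dist S : G -> G -> R)].

Definition cyclic_subgroup (G : groupType) (g : G) : set G :=
  [set x | exists n : nat, x = (g ^+ n)%g \/ x = (g ^- n)%g].

Definition finite_index (G : groupType) (H : set G) : Prop :=
  finite_set [set [set (x * h)%g | h in H] | x in [set: G]].

Definition nonelementary (G : groupType) : Prop :=
  forall g : G, ~ finite_index (cyclic_subgroup g).

Section Boundary.
Context {R : realType} {G : groupType}.
Variable d : G -> G -> R.
Implicit Types (s t : nat -> G).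

(* (s_m, t_n)_o tends to infinity as m and n tend to infinity *)
Definition gromov_equiv s t : Prop :=
  (fun p : nat * nat => gromov_product d 1%g (s p.1) (t p.2))
    @ filter_prod \oo \oo --> +oo%R.

Definition gromov_sequence s : Prop := gromov_equiv s s.

Definition gromov_class s : set (nat -> G) :=
  [set t | gromov_sequence t /\ gromov_equiv s t].

(* A boundary point is the set of all sequences converging to it.  The second
   alternative provides a dummy point exactly when there is no Gromov sequence
   at all, because the types of the measure theory library are inhabited; it
   plays no role for infinite hyperbolic groups. *)
Definition is_boundary_point (c : set (nat -> G)) : Prop :=
  (exists2 s, gromov_sequence s & c = gromov_class s) \/
  (~ (exists s, gromov_sequence s) /\ c = set0).

Record boundary := Boundary {
  converging_to : set (nat -> G);
  _ : is_boundary_point converging_to }.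

Lemma boundary_inhabited : exists c, is_boundary_point c.
Proof.
have [[s hs]|ns] := pselect (exists s, gromov_sequence s).
  by exists (gromov_class s); left; exists s.
by exists set0; right.
Qed.

HB.instance Definition _ := gen_eqMixin boundary.
HB.instance Definition _ := gen_choiceMixin boundary.
HB.instance Definition _ :=
  isPointed.Build boundary (Boundary (projT2 (cid boundary_inhabited))).

Implicit Types (xi eta : boundary) (U : set boundary).

(* (xi, eta)_o: supremum of liminf_{m,n} (s_m, t_n)_o over s -> xi, t -> eta *)
Definition boundary_product xi eta : \bar R :=
  ereal_sup [set limf_einf
      (fun p : nat * nat => (gromov_product d 1%g (s p.1) (t p.2))%:E)
      (filter_prod \oo \oo)
    | s in converging_to xi & t in converging_to eta].

(* the standard topology: the sets {eta | (xi, eta)_o > r} form a basis of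
   (not necessarily open) neighborhoods of xi *)
Definition boundary_open U : Prop :=
  forall xi, U xi ->
    exists r : R, forall eta, (r%:E < boundary_product xi eta)%E -> U eta.

Lemma boundary_openT : boundary_open setT.
Proof. by move=> xi _; exists 0. Qed.

Lemma boundary_openI : setI_closed boundary_open.
Proof.
move=> U V oU oV xi [/oU[r Ur] /oV[q Vq]].
exists (Num.max r q) => eta rq; split; [apply: Ur|apply: Vq];
  by apply: le_lt_trans rq; rewrite lee_fin le_max lexx ?orbT.
Qed.

Lemma boundary_open_bigU (I : Type) (f : I -> set boundary) :
  (forall i, boundary_open (f i)) -> boundary_open (\bigcup_i f i).
Proof.
move=> of_ xi [i _ /of_[r fr]]; exists r => eta /fr feta.
by exists i.
Qed.

HB.instance Definition _ := isOpenTopological.Build boundary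
  boundary_openT boundary_openI boundary_open_bigU.

(* x xi is the boundary point [x s_n] for (any) s_n -> xi *)
Definition boundary_act (x : G) xi : boundary :=
  xget xi [set eta | exists2 s, converging_to xi s &
                                converging_to eta (fun n => (x * s n)%g)].

Definition busemann (x : G) xi : \bar R :=
  ereal_sup [set limn_esup (fun n => (d x (s n) - d 1%g (s n))%:E)
            | s in converging_to xi].

End Boundary.

Notation borel_boundary d := (g_sigma_algebraType (@open (boundary d))).

(* mu is the push-forward x_* nu, as a finite measure; Radon_Nikodym is junk when
   mu is not dominated by nu, whence the explicit absolute continuity *)
Definition patterson_sullivan (R : realType) (G : groupType) (d : G -> G -> R)
    (nu : probability (borel_boundary d) R) : Prop :=
  exists2 C : R, 1 < C & forall x : G,
    exists mu : {finite_measure set (borel_boundary d) -> \bar R},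
    [/\ forall A, measurable A -> mu A = nu (boundary_act x @^-1` A),
        mu `<< nu &
        {ae nu, forall xi,
          let e := expR (- fine (growth_rate d) * fine (busemann x xi)) in
          ((C^-1 * e)%:E <= Radon_Nikodym (charge_of_finite_measure mu) nu xi
            <= (C * e)%:E)%E}].

(* Main.v *)
Require Import Defs.
From HB Require Import structures.
From mathcomp Require Import all_boot all_order all_algebra finmap.
From mathcomp Require Import all_classical all_reals all_analysis.
From mathcomp Require Import measurable_realfun zify lra.

Set Implicit Arguments.
Unset Strict Implicit.
Unset Printing Implicit Defensive.

Import Order.TTheory GRing.Theory Num.Theory numFieldNormedType.Exports.

Local Open Scope classical_set_scope.
Local Open Scope ring_scope.

(** Fix a finite generating set S and write |g| for the word norm.  The proof rests on
    good pairs (g, g') for an element x: both g and g' are cyclically reduced up to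
    a constant, and g' = g x b without cancellation, where b has bounded norm.  Let d
    be a pseudo-metric of the class under study.  Its Gromov product is bounded by
    that of the word metric, so for d as well nothing cancels in the powers of g and
    of g' or in the product g (x b).  Hence the translation lengths of g and g' are
    d(1, g) and d(1, g') up to a constant, and their difference is d(1, x) up to a
    constant that does not depend on x.  If the conjugacy classes in a set E include
    those of a good pair for every x, then two such pseudo-metrics with the same
    translation lengths on E are at bounded distance from each other: E is rigid,
    with similarity ratio 1 ([rigid_of_good_pairs]).

    It remains to see that almost every ray runs through good pairs for every x,
    arbitrarily far out.  In a non-elementary hyperbolic group one can continue any
    position h by a bounded path to a good pair for x ([good_pairs]): there is a
    finite family of long elements, the connectors, that point in so different
    directions that some connector avoids any few prescribed cancellations.  They
    exist because no point at infinity has a finite orbit: on the stabilizer of a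
    point the Busemann function is a quasi-morphism with finite fibres, so a
    stabilizer of finite index would contain a cyclic group of finite index
    ([stabilizer_infinite_index]).

    On the measure side, quasi-conformality and the connectors give the shadow lemma:
    the shadow of h has measure exp (- v |h|) up to constants, with v the growth rate
    ([shadow_measure_ge], [shadow_measure_le]).  So in each shadow a definite
    proportion of the points have a good pair for x right behind h.  If the closed set of points whose rays
    meet no good pair beyond N had positive measure, this would contradict the
    continuity of the measure along the neighborhoods of that set at the scales
    n = N, N + 1, and so on ([recurrence]).

    Since the rays of the theorem need only be roughly geodesic, the good pairs near a
    geodesic ray can be put on it ([ray_through_good_pairs]).  For the sparse set,
    choose the good pairs far apart: their translation lengths grow as fast as their
    positions on the ray ([sparse_rigid]).

    The comparison of Gromov products, and the hyperbolicity of the word metric of S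
    when only some other word metric is known to be hyperbolic, both follow from the
    stability of quasi-geodesics ([morse]).  It is stated here for metrics that
    satisfy the four-point condition and need not be geodesic, because the metrics
    in the definition of the class are of this kind. *)

(** * Word metrics *)

Section WordMetric.
Context {R : realType} {G : groupType} {S : set G}.
Implicit Types (g h p x y z : G).

Definition word_norm (S : set G) g : nat :=
  xget 0%N [set k | is_word S k g /\ forall j, is_word S j g -> (k <= j)%N].

Lemma word_distE x y :
  word_dist S x y = (word_norm S (x^-1 * y)%g)%:R :> R.
Proof. by []. Qed.

Hypothesis genS : generates S.

Lemma word_normP g :
  is_word S (word_norm S g) g /\
  forall j, is_word S j g -> (word_norm S g <= j)%N.
Proof.
rewrite /word_norm; case: xgetP => [k _ //|nk].
have [k0 hk0] := genS g.
have ex : exists k, `[< is_word S k g >] by exists k0; apply/asboolP.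
case: (ex_minnP ex) => k /asboolP wk mk; exfalso; apply: (nk k); split=> // j wj.
by apply: mk; apply/asboolP.
Qed.

Lemma word_norm_is_word g : is_word S (word_norm S g) g.
Proof. by have [] := word_normP g. Qed.

Lemma word_norm_le g k : is_word S k g -> (word_norm S g <= k)%N.
Proof. by have [_] := word_normP g; apply. Qed.

Lemma is_wordP k g : is_word S k g <->
  exists w : seq G, [/\ size w = k, forall s, s \in w -> S s \/ S s^-1%g &
                        g = (\prod_(s <- w) s)%g].
Proof.
split=> [[w [ws ->]]|[w [sw ws ->]]].
  by exists w; rewrite size_tuple.
by subst k; exists (in_tuple w).
Qed.

Lemma is_wordM j k g h :
  is_word S j g -> is_word S k h -> is_word S (j + k) (g * h)%g.
Proof.
move=> /is_wordP[u [su us ->]] /is_wordP[v [sv vs ->]]; apply/is_wordP.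
exists (u ++ v); split; first by rewrite size_cat su sv.
  by move=> s; rewrite mem_cat => /orP[/us|/vs].
by rewrite big_cat.
Qed.

Lemma is_wordV k g : is_word S k g -> is_word S k g^-1%g.
Proof.
move=> /is_wordP[u [su us ->]]; apply/is_wordP.
exists (rev [seq s^-1%g | s <- u]); split; first by rewrite size_rev size_map.
  move=> s; rewrite mem_rev => /mapP[t /us]; rewrite or_comm => ut ->.
  by rewrite invgK.
elim: u {su us} => [|a u ih]; first by rewrite !big_nil invg1.
rewrite big_cons invgM ih /= rev_cons -cats1 big_cat /= big_seq1 //.
Qed.

Lemma word_norm1 : word_norm S 1%g = 0%N.
Proof.
apply/eqP; rewrite -leqn0; apply: word_norm_le; apply/is_wordP.
by exists [::]; split=> //; rewrite big_nil.
Qed.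

Lemma word_norm_eq0 g : word_norm S g = 0%N -> g = 1%g.
Proof.
have := word_norm_is_word g => + g0; rewrite g0 => /is_wordP[w [/size0nil -> _ ->]].
by rewrite big_nil.
Qed.

Lemma word_normM g h : (word_norm S (g * h)%g <= word_norm S g + word_norm S h)%N.
Proof. by apply/word_norm_le/is_wordM; exact: word_norm_is_word. Qed.

Lemma word_normV g : word_norm S g^-1%g = word_norm S g.
Proof.
apply/eqP; rewrite eqn_leq; apply/andP; split.
  by apply/word_norm_le/is_wordV/word_norm_is_word.
by apply: word_norm_le; rewrite -{2}(invgK g); apply/is_wordV/word_norm_is_word.
Qed.

Lemma word_norm_split g k : (k <= word_norm S g)%N ->
  exists p, word_norm S p = k /\ word_norm S (p^-1 * g)%g = (word_norm S g - k)%N.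
Proof.
move=> kg; have /is_wordP[w [sw ws gE]] := word_norm_is_word g.
pose p := (\prod_(s <- take k w) s)%g; pose q := (\prod_(s <- drop k w) s)%g.
have pq : g = (p * q)%g by rewrite gE -{1}(cat_take_drop k w) big_cat.
have np : (word_norm S p <= k)%N.
  apply/word_norm_le/is_wordP; exists (take k w); split=> //.
    by rewrite size_take sw; case: ltngtP kg.
  by move=> s /mem_take /ws.
have nq : (word_norm S q <= word_norm S g - k)%N.
  apply/word_norm_le/is_wordP; exists (drop k w); split=> //.
    by rewrite size_drop sw.
  by move=> s /mem_drop /ws.
have := word_normM p q; rewrite -pq => le.
have pgE : (p^-1 * g = q)%g by rewrite pq mulKg.
by exists p; rewrite pgE; split; lia.
Qed.

Lemma word_norm_finite n : finite_set S -> finite_set [set g | (word_norm S g <= n)%N].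
Proof.
move=> finS; pose S1 := S `|` [set s^-1%g | s in S] `|` [set 1%g].
have finS1 : finite_set S1.
  by rewrite !finite_setU; split; [split=> //; exact: finite_image|exact: finite_set1].
suff fin k : finite_set [set g | exists w : seq G,
    [/\ size w = k, forall s, s \in w -> S1 s & g = (\prod_(s <- w) s)%g]].
  apply: sub_finite_set (fin n) => g /= gn.
  have /is_wordP[w [sw ws gE]] := word_norm_is_word g.
  exists (w ++ nseq (n - word_norm S g) 1%g); split.
  - by rewrite size_cat size_nseq sw subnKC.
  - move=> s; rewrite mem_cat mem_nseq => /orP[/ws[]|/andP[_ /eqP->]].
    + by left; left.
    + by left; right; exists s^-1%g; rewrite ?invgK.
    + by right.
  - rewrite big_cat /= -gE [X in (_ * X)%g]big1_seq ?mulg1// => s.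
    by rewrite mem_nseq => /andP[_ /andP[_ /eqP]].
elim: k => [|k ih].
  apply: sub_finite_set (finite_set1 1%g) => g [w [/size0nil -> _ ->]] /=.
  by rewrite big_nil.
apply: sub_finite_set (finite_image2 _ finS1 ih) => g [[|a w] [//= [sw] ws ->]].
exists a; first by apply: ws; rewrite mem_head.
exists (\prod_(s <- w) s)%g; last by rewrite big_cons.
by exists w; split=> // s sw'; apply: ws; rewrite inE sw' orbT.
Qed.

Lemma word_dist_pseudo_metric : pseudo_metric (word_dist S : G -> G -> R).
Proof.
split=> [x|x y|x y|x y z]; rewrite ?word_distE.
- by rewrite mulVg word_norm1.
- by rewrite ler0n.
- by rewrite -word_normV invgM invgK.
- rewrite -natrD ler_nat.
  by have := word_normM (x^-1 * y)%g (y^-1 * z)%g; rewrite mulgA mulgK.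
Qed.

Lemma word_dist_left_invariant : left_invariant (word_dist S : G -> G -> R).
Proof.
by move=> g x y; rewrite !word_distE invgM -mulgA mulKg.
Qed.

Lemma word_dist1 g : word_dist S 1%g g = (word_norm S g)%:R :> R.
Proof. by rewrite word_distE invg1 mul1g. Qed.

End WordMetric.

Lemma word_norm_le_word_norm (G : groupType) (S S' : set G) : generates S ->
  generates S' -> finite_set S' ->
  exists A, forall g, (word_norm S g <= A * word_norm S' g)%N.
Proof.
move=> genS genS' finS'.
pose A := (\max_(s <- fset_set S') word_norm S s)%N.
exists A => g; have /is_wordP[w [<- ws ->]] := word_norm_is_word genS' g.
elim: w ws => [|a w ih] ws; first by rewrite big_nil word_norm1.
rewrite big_cons /= mulnS; apply: leq_trans (word_normM genS _ _) _.
apply: leq_add; last by apply: ih => s sw; apply: ws; rewrite inE sw orbT.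
have max b : b \in S' -> (word_norm S b <= A)%N.
  by move=> Sb; apply: leq_bigmax_seq => //; rewrite in_fset_set.
have [Sa|Sa] := ws a (mem_head _ _); first by apply: max; rewrite inE.
by rewrite -(word_normV genS); apply: max; rewrite inE.
Qed.
(** * The four-point condition and stability of quasi-geodesics *)

Section Hyperbolic.
Context {R : realType} {G : groupType}.
Implicit Types (d : G -> G -> R) (w x y z g h : G).

(** The constant delta of [gromov_hyperbolic], made explicit so that further
    constants can be computed from it. *)
Definition hyperbolic_at (delta : R) d : Prop :=
  pseudo_metric d /\ forall w x y z,
    Num.min (gromov_product d w x y) (gromov_product d w y z) - delta
      <= gromov_product d w x z.

Section FourPoint.
Variables (delta : R) (d : G -> G -> R).
Hypothesis hyp : hyperbolic_at delta d.
Local Notation gp := (gromov_product d).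

Lemma dist_xx x : d x x = 0. Proof. by case: hyp => -[]. Qed.
Lemma dist_ge0 x y : 0 <= d x y. Proof. by case: hyp => -[]. Qed.
Lemma distC x y : d x y = d y x. Proof. by case: hyp => -[]. Qed.
Lemma dist_tri x y z : d x z <= d x y + d y z. Proof. by case: hyp => -[]. Qed.

Lemma gpC w x y : gp w x y = gp w y x.
Proof. by rewrite /gromov_product (distC x y) [d w x + _]addrC. Qed.

Lemma gp_ge0 w x y : 0 <= gp w x y.
Proof. by have := dist_tri x w y; rewrite (distC x w) /gromov_product; lra. Qed.

Lemma gp_lel w x y : gp w x y <= d w x.
Proof. by have := dist_tri w x y; rewrite /gromov_product; lra. Qed.

Lemma gp_ler w x y : gp w x y <= d w y.
Proof. by rewrite gpC gp_lel. Qed.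

Lemma gp_xx w x : gp w x x = d w x.
Proof. by rewrite /gromov_product dist_xx; lra. Qed.

Lemma gp_wx w x : gp w w x = 0.
Proof. by rewrite /gromov_product dist_xx; lra. Qed.

Lemma gp_xw w x : gp w x w = 0.
Proof. by rewrite gpC gp_wx. Qed.

Lemma gp_lip w x y z : gp w x y <= gp w x z + d y z.
Proof.
have := dist_tri w z y; have := dist_tri x y z.
by rewrite (distC z y) /gromov_product; lra.
Qed.

Lemma gp_lipl w x y z : gp w x y <= gp w z y + d x z.
Proof. by rewrite !(gpC w _ y) gp_lip. Qed.

Lemma gp_ends x y z : gp x y z + gp y x z = d x y.
Proof. by rewrite /gromov_product (distC y x); lra. Qed.

Lemma gp_ge_dist w x y : d w x - d x y <= gp w x y.
Proof. by have := dist_tri w y x; rewrite (distC y x) /gromov_product; lra. Qed.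

Lemma delta_ge0 : 0 <= delta.
Proof.
by have [_ /(_ 1 1 1 1)%g] := hyp; rewrite minxx !gp_xx dist_xx; lra.
Qed.

(** The four-point condition as an alternative, the shape in which linear
    arithmetic can use it. *)
Lemma gp_hyp w x y z : gp w x y <= gp w x z + delta \/ gp w y z <= gp w x z + delta.
Proof.
have [_ /(_ w x y z)] := hyp; rewrite minEle.
by case: ifP => _ h; [left|right]; lra.
Qed.

Lemma dist_hyp w x y z :
  d w y + d x z <= d w x + d y z + 2 * delta \/
  d w y + d x z <= d w z + d x y + 2 * delta.
Proof.
by case: (gp_hyp w x y z); rewrite /gromov_product => h; [right|left]; lra.
Qed.

(** Halving a chain of length [2 ^ m] costs [delta] at each of the [m] levels. *)
Lemma gp_chain m N (p : nat -> G) w c : (0 < N <= 2 ^ m)%N ->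
  (forall i, (i < N)%N -> c <= gp w (p i) (p i.+1)) ->
  c - m%:R * delta <= gp w (p 0%N) (p N).
Proof.
have d0 := delta_ge0.
elim: m N p => [|m ih] N p /andP[N0 Nm] hc.
  have -> : N = 1%N by move: Nm; rewrite expn0; lia.
  by rewrite mul0r subr0; apply: hc.
have [Nm'|Nm'] := leqP N (2 ^ m).
  apply: le_trans (ih N p _ hc); last by rewrite N0.
  by rewrite -natr1; lra.
have h1 : c - m%:R * delta <= gp w (p 0%N) (p (2 ^ m)%N).
  apply: ih => [|i im]; first by rewrite expn_gt0 leqnn.
  by apply: hc; lia.
have h2 : c - m%:R * delta <= gp w (p (2 ^ m)%N) (p N).
  have := ih (N - 2 ^ m)%N (fun i => p (2 ^ m + i)%N).
  rewrite addn0 subnKC; last exact: ltnW.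
  apply; first by move: Nm Nm'; rewrite expnS; lia.
  by move=> i iN; rewrite addnS; apply: hc; lia.
by rewrite -natr1; case: (gp_hyp w (p 0%N) (p (2 ^ m)%N) (p N)); lra.
Qed.

(** A path from far away to [w] must come back to [w] through the sphere of radius
    [H], up to a logarithmic error: the first edge whose Gromov product at [w]
    is small cannot be far out, and before it the chain inequality keeps the
    path on the side of its starting point. *)
Lemma path_crosses (y : nat -> G) k m w H J : y k = w -> (k <= 2 ^ m)%N ->
  0 < H -> H <= d w (y 0%N) ->
  (forall t, (t < k)%N -> d (y t) (y t.+1) <= J) ->
  exists t, [/\ (t < k)%N, H <= gp w (y 0%N) (y t)
    & d w (y t) <= H + m%:R * delta + J].
Proof.
move=> yk km H0 Hd hJ.
have k0 : (0 < k)%N.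
  by rewrite lt0n; apply/eqP => k0; move: Hd; rewrite -k0 yk dist_xx; lra.
pose P t := (t < k)%N && (gp w (y t) (y t.+1) < H + m%:R * delta).
have exP : exists t, P t.
  have [//|nP] := pselect (exists t, P t); exfalso.
  have : H + m%:R * delta - m%:R * delta <= gp w (y 0%N) (y k).
    apply: gp_chain => [|i ik]; first by rewrite k0.
    rewrite leNgt; apply/negP => hi; apply: nP; exists i.
    by rewrite /P ik.
  by rewrite yk gp_xw; lra.
case: (ex_minnP exP) => t /andP[tk ht] mint; exists t; split => //.
  case: (posnP t) => [->|t0]; first by rewrite gp_xx.
  have : H + m%:R * delta - m%:R * delta <= gp w (y 0%N) (y t).
    apply: gp_chain => [|i it]; first by rewrite t0; lia.
    rewrite leNgt; apply/negP => hi; have := mint i.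
    by rewrite /P hi andbT => /(_ ltac:(lia)); lia.
  by lra.
by have := gp_ge_dist w (y t) (y t.+1); have := hJ t tk; lra.
Qed.

End FourPoint.

Definition quasi_geodesic d (L : R) (n : nat) (x : nat -> G) : Prop :=
  forall i j, (i <= j <= n)%N ->
    d (x i) (x j) <= L * (j - i)%:R + L /\ (j - i)%:R <= L * d (x i) (x j) + L.

Lemma quasi_geodesic_sub d L n (x : nat -> G) i m : (i + m <= n)%N -> quasi_geodesic d L n x ->
  quasi_geodesic d L m (fun t => x (i + t)%N).
Proof. by move=> imn q a b ab; rewrite -(subnDl i); apply: q; lia. Qed.

Section Morse.
Variables (delta : R) (d : G -> G -> R).
Hypothesis hyp : hyperbolic_at delta d.
Local Notation gp := (gromov_product d).

Let morse_log_const L (m : nat) : R :=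
  L * (L * (2 * m%:R * delta + 4 * L + 4 * delta) + L) + L.

(** Let [w = x k] and let [H] be the product at [w] of the two ends.  Both halves
    of the path cross the sphere of radius [H] around [w], on the same side of
    [w], hence at two points that are logarithmically close; a quasi-geodesic
    cannot meet [w] between them unless [H] is logarithmic, too. *)
Lemma quasi_geodesic_log L n m (x : nat -> G) k : 1 <= L -> quasi_geodesic d L n x ->
  (n <= 2 ^ m)%N -> (k <= n)%N -> gp (x k) (x 0%N) (x n) <= morse_log_const L m.
Proof.
move=> L1 q nm kn; have d0 := delta_ge0 hyp.
have m0 : 0 <= m%:R * delta by rewrite mulr_ge0.
set H := gp _ _ _; set w := x k.
have Lc : 0 <= morse_log_const L m.
  rewrite /morse_log_const; rewrite !(addr_ge0, mulr_ge0)//; lra.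
have [H0|H0] := leP H 0; first lra.
have step t : (t < n)%N -> d (x t) (x t.+1) <= 2 * L.
  by move=> tn; have [] := q t t.+1 ltac:(lia); rewrite subSnn; lra.
have [i [ik Hi di]] : exists t, [/\ (t < k)%N, H <= gp w (x 0%N) (x t)
    & d w (x t) <= H + m%:R * delta + 2 * L].
  apply: (path_crosses hyp) => //; first lia; first exact: gp_lel hyp _ _ _.
  by move=> t tk; apply: step; lia.
have [t [tk Ht dt]] : exists t, [/\ (t < n - k)%N, H <= gp w (x n) (x (n - t)%N)
    & d w (x (n - t)%N) <= H + m%:R * delta + 2 * L].
  have := @path_crosses _ _ hyp (fun t => x (n - t)%N) (n - k) m w H (2 * L).
  rewrite subKn// subn0; apply => //; first lia; first exact: gp_ler hyp _ _ _.
  move=> t tk; rewrite (distC hyp).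
  have -> : (n - t = (n - t.+1).+1)%N by lia.
  by apply: step; lia.
have tj : (k <= n - t <= n)%N by clear -tk; lia.
move: (n - t)%N Ht dt tj => j Hj dj tj {t tk}.
have ij : (i <= j <= n)%N by clear -ik tj; lia.
have ikn : (i <= k <= n)%N by clear -ik kn; lia.
have kj : (k - i <= j - i)%N by clear -tj; lia.
have same_side : H - 2 * delta <= gp w (x i) (x j).
  have := gp_hyp hyp w (x i) (x 0%N) (x j); have := gp_hyp hyp w (x 0%N) (x n) (x j).
  by rewrite (gpC hyp w (x i)); case=> h1; case=> h2; rewrite -/H in h1; lra.
have dij : d (x i) (x j) <= 2 * m%:R * delta + 4 * L + 4 * delta.
  by move: same_side; rewrite /gromov_product; lra.
have [_ hij] := q i j ij.
have [hik _] := q i k ikn.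
have := gp_ler hyp w (x 0%N) (x i); rewrite (distC hyp w).
move: kj; rewrite -(ler_nat R) => kj; rewrite /morse_log_const => Hk.
have h1 : L * d (x i) (x j) <= L * (2 * m%:R * delta + 4 * L + 4 * delta).
  by apply: ler_wpM2l => //; lra.
have h2 : L * (k - i)%:R <= L * (L * (2 * m%:R * delta + 4 * L + 4 * delta) + L).
  by apply: ler_wpM2l => //; lra.
by lra.
Qed.

Section LocalToGlobal.
Variables (n n0 : nat) (B : R).

Let local_bound (x : nat -> G) := forall i k j, (i <= k <= j)%N -> (j <= n)%N ->
  (j - i <= 2 * n0)%N -> gp (x k) (x i) (x j) <= B.
Let long_steps (x : nat -> G) := forall i, (i + n0 <= n)%N ->
  2 * B + 3 * delta + 1 <= d (x i) (x (i + n0)%N).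

Let one_sided (x : nat -> G) i k s : (0 < n0)%N -> local_bound x -> long_steps x ->
  (i <= k)%N -> (s <= n0)%N -> (k + s <= n)%N ->
  gp (x k) (x i) (x (k + s)%N) <= B + delta.
Proof.
move=> n00 lb ls; have d0 := delta_ge0 hyp.
elim/ltn_ind: k s => k ih s ik sn0 ksn.
have [ki|ki] := leqP (k - i) n0.
  by have := lb i k (k + s)%N ltac:(lia) ksn ltac:(lia); lra.
set k' := (k - n0)%N.
have h1 : gp (x k') (x i) (x k) <= B + delta.
  have := ih k' ltac:(lia) n0 ltac:(lia) (leqnn _) ltac:(lia).
  by rewrite /k' subnK//; lia.
have h2 : gp (x k) (x k') (x (k + s)%N) <= B by apply: lb => //; lia.
have := ls k' ltac:(lia); rewrite /k' subnK -/k'; last lia.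
have := gp_ends hyp (x k) (x k') (x i).
rewrite (gpC hyp (x k') (x k)) (distC hyp (x k)).
by have := gp_hyp hyp (x k) (x k') (x i) (x (k + s)%N); case; lra.
Qed.

(** A step is so long that the cancellation at its two ends does not use it up;
    so the one-sided bound propagates along the path, and comparing [j] with
    the end of the step that follows [k] gives the two-sided bound. *)
Lemma local_to_global (x : nat -> G) i k j : (0 < n0)%N -> local_bound x -> long_steps x ->
  (i <= k <= j)%N -> (j <= n)%N -> gp (x k) (x i) (x j) <= B + 2 * delta.
Proof.
move=> n00 lb ls ikj jn; have d0 := delta_ge0 hyp.
have [kj|kj] := leqP (j - k) n0.
  have := @one_sided x i k (j - k) n00 lb ls ltac:(lia) kj ltac:(lia).
  by rewrite subnKC; last lia; lra.
have h1 := @one_sided x i k n0 n00 lb ls ltac:(lia) (leqnn _) ltac:(lia).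
have h2 : gp (x (k + n0)%N) (x j) (x k) <= B + delta.
  have := @one_sided (fun t => x (n - t)%N) (n - j)%N (n - (k + n0))%N n0 n00.
  rewrite !subKn; try lia.
  have -> : (n - (n - (k + n0) + n0) = k)%N by lia.
  apply; try lia.
    move=> a b c abc cn ac; rewrite (gpC hyp); apply: lb; lia.
  move=> a an; rewrite (distC hyp).
  have -> : (n - a = (n - (a + n0)) + n0)%N by lia.
  by apply: ls; lia.
have := ls k ltac:(lia).
have := gp_ends hyp (x k) (x (k + n0)%N) (x j).
rewrite (gpC hyp (x (k + n0)%N) (x k)) (gpC hyp (x k) (x (k + n0)%N)).
by have := gp_hyp hyp (x k) (x i) (x j) (x (k + n0)%N); case; lra.
Qed.

End LocalToGlobal.

Lemma exp2_beats_linear (a b : R) : 0 <= a -> 0 <= b ->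
  exists m : nat, a * m%:R + b <= (2 ^ m)%:R.
Proof.
move=> a0 b0; pose p := (Num.truncn (2 * a + b)).+1.
have hp : 2 * a + b <= p%:R.
  by rewrite ltW// /p; apply: truncnS_gt.
exists (p + p)%N; rewrite expnD natrM.
have pe : p%:R + 1 <= (2 ^ p)%:R :> R.
  by rewrite natr1 ler_nat; apply: ltn_expl.
have p0 : 0 <= p%:R :> R by [].
apply: (@le_trans _ _ ((2 * a + b) * (p%:R + 1))).
  by rewrite natrD; have := mulr_ge0 b0 p0; lra.
by apply: ler_pM; lra.
Qed.

(** Stability of quasi-geodesics, in the form that needs no geodesics in [d]: a
    point of a quasi-geodesic sees its two ends in opposite directions.  The
    logarithmic bound is sublinear, so at some scale it falls below half the
    step length, and from that scale on the local-to-global principle applies. *)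
Lemma morse (L : R) : 1 <= L -> exists2 K : R, 0 <= K &
  forall n (x : nat -> G) k, quasi_geodesic d L n x -> (k <= n)%N ->
    gp (x k) (x 0%N) (x n) <= K.
Proof.
move=> L1; have d0 := delta_ge0 hyp.
pose c := morse_log_const L.
have c_ge0 m : 0 <= c m.
  by rewrite /c /morse_log_const !(addr_ge0, mulr_ge0)//; lra.
have [m hm] : exists m : nat, L * (2 * c m.+1 + 3 * delta + 1) + L <= (2 ^ m)%:R.
  pose a := 4 * L * (L * L) * delta; pose b := L * (2 * c 1%N + 3 * delta + 1) + L.
  have [|| m hm] := @exp2_beats_linear a b.
  - by rewrite /a !mulr_ge0//; lra.
  - by rewrite /b addr_ge0 ?mulr_ge0//; have := c_ge0 1%N; lra.
  exists m; apply: le_trans hm.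
  by rewrite /a /b /c /morse_log_const -natr1; lra.
have n00 : (0 < 2 ^ m)%N by rewrite expn_gt0.
(* steps of length [2 ^ m] satisfy the hypothesis of [local_to_global] with the
   bound [c m.+1] that [quasi_geodesic_log] gives for paths of twice this length *)
exists (c m.+1 + 2 * delta) => [|n x k q kn]; first by have := c_ge0 m.+1; lra.
apply: (@local_to_global n (2 ^ m) (c m.+1) x 0%N k n) => //.
- move=> i k' j ikj jn ij; rewrite -expnS in ij.
  have := @quasi_geodesic_log L (j - i) m.+1 (fun t => x (i + t)%N) (k' - i) L1.
  rewrite addn0 !subnKC; try lia; apply => //; last lia.
  by apply: quasi_geodesic_sub q; lia.
- move=> i iN; have [_] := q i (i + 2 ^ m)%N ltac:(lia).
  rewrite addKn => h.
  have : L * (2 * c m.+1 + 3 * delta + 1) <= L * d (x i) (x (i + 2 ^ m)%N) by lra.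
  by rewrite ler_pM2l//; lra.
Qed.

End Morse.

End Hyperbolic.
(** * Word metrics under quasi-isometries *)

Section GeodesicPaths.
Context {R : realType} {G : groupType}.
Implicit Types (d : G -> G -> R) (x y z p q : G) (c : nat -> G).

Definition geodesic d (n : nat) c : Prop :=
  forall i j, (i <= j <= n)%N -> d (c i) (c j) = (j - i)%:R.

Definition between d x p y : Prop := d x p + d p y = d x y.

Lemma geodesic_of_steps d n c : pseudo_metric d -> d (c 0%N) (c n) = n%:R ->
  (forall i, (i < n)%N -> d (c i) (c i.+1) <= 1) -> geodesic d n c.
Proof.
move=> [dxx _ dC dtri] d0n hstep.
have le i m : (i + m <= n)%N -> d (c i) (c (i + m)%N) <= m%:R.
  elim: m => [|m ih] imn; first by rewrite addn0 dxx.
  rewrite addnS; have := dtri (c i) (c (i + m)%N) (c (i + m).+1).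
  have := hstep (i + m)%N ltac:(lia); have := ih ltac:(lia).
  by rewrite -natr1; lra.
move=> i j ijn; apply/eqP; rewrite eq_le; apply/andP; split.
  by have := le i (j - i)%N; rewrite subnKC; [apply|]; lia.
have := le 0%N i ltac:(lia); have := le j (n - j)%N; rewrite subnKC; last lia.
move=> /(_ (leqnn _)); rewrite add0n.
have := dtri (c 0%N) (c i) (c n); have := dtri (c i) (c j) (c n); rewrite d0n.
have -> : n%:R = i%:R + (j - i)%:R + (n - j)%:R :> R by rewrite -!natrD; congr _%:R; lia.
by lra.
Qed.

Lemma geodesic_between d n c k : geodesic d n c -> (k <= n)%N ->
  between d (c 0%N) (c k) (c n).
Proof. by move=> gc kn; rewrite /between !gc -?natrD; [congr _%:R|..]; lia. Qed.

End GeodesicPaths.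

Section WordGeodesics.
Context {R : realType} {G : groupType} {S : set G}.
Hypothesis genS : generates S.
Implicit Types (x y z p q : G) (c : nat -> G).
Local Notation dS := (word_dist S : G -> G -> R).
Let pm := @word_dist_pseudo_metric R G S genS.

Lemma word_geodesic x y : exists c, [/\ c 0%N = x, c (word_norm S (x^-1 * y)%g) = y
  & geodesic dS (word_norm S (x^-1 * y)%g) c].
Proof.
have /is_wordP[w [sw ws xyE]] := word_norm_is_word genS (x^-1 * y)%g.
pose c i := (x * \prod_(s <- take i w) s)%g.
have c0 : c 0%N = x by rewrite /c take0 big_nil mulg1.
have cn : c (word_norm S (x^-1 * y)%g) = y by rewrite /c -sw take_size -xyE mulVKg.
exists c; split => //; apply: geodesic_of_steps => //; first by rewrite c0 cn.
move=> i iw; rewrite word_distE /c (take_nth 1%g) ?sw// -cats1 big_cat /= big_seq1.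
rewrite invgM -!mulgA !mulKg lern1.
apply: (word_norm_le genS); apply/is_wordP.
exists [:: nth 1%g w i]; split => //; last by rewrite big_seq1.
by move=> s; rewrite inE => /eqP ->; apply: ws; rewrite mem_nth ?sw.
Qed.

Lemma between_geodesic x p y : between dS x p y -> exists n c k,
  [/\ c 0%N = x, c n = y, c k = p, (k <= n)%N & geodesic dS n c].
Proof.
move=> xpy; have [a [a0 ak ga]] := word_geodesic x p.
have [b [b0 bl gb]] := word_geodesic p y.
set k := word_norm _ _ in ak ga; set l := word_norm _ _ in bl gb.
pose c i := if (i <= k)%N then a i else b (i - k)%N.
have c0 : c 0%N = x by rewrite /c leq0n.
have cn : c (k + l)%N = y.
  rewrite /c; case: leqP => h; last by rewrite addKn.
  have l0 : l = 0%N by lia.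
  by rewrite l0 addn0 ak -b0 -l0.
exists (k + l)%N, c, k; split => //; [by rewrite /c leqnn|lia|].
apply: geodesic_of_steps => //; first by rewrite c0 cn -xpy natrD.
move=> i ikl; rewrite /c; case: (ltngtP i k) => ik.
- by rewrite ga ?subSnn//; lia.
- by rewrite gb; [rewrite lern1|]; lia.
- by rewrite ik ak -b0 subSnn gb; [|lia].
Qed.

Section QuasiIsometry.
Variables (delta : R) (d0 : G -> G -> R) (L : R).
Hypothesis hyp : hyperbolic_at delta d0.
Hypothesis L1 : 1 <= L.
Hypothesis d0_le : forall x y, d0 x y <= L * dS x y + L.
Hypothesis d0_ge : forall x y, dS x y <= L * d0 x y + L.

Lemma geodesic_quasi n c : geodesic dS n c -> quasi_geodesic d0 L n c.
Proof. by move=> gc i j ijn; rewrite -(gc i j ijn). Qed.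

Lemma between_product : exists2 K : R, 0 <= K &
  forall x p y, between dS x p y -> gromov_product d0 p x y <= K.
Proof.
have [K K0 hK] := morse hyp L1; exists K => // x p y.
move=> /between_geodesic[n [c [k [<- <- <- kn /geodesic_quasi qc]]]].
exact: hK.
Qed.

(** Walk along a word geodesic from [x] to [y] to the first place that is as far
    from [x] as [p] is; it is close to [p] because [p] sees [x] and [y] in
    opposite directions. *)
Lemma near_geodesic (K : R) : 0 <= K -> exists2 C : R, 0 <= C &
  forall x p y, gromov_product d0 p x y <= K ->
    exists2 q, between dS x q y & dS p q <= C.
Proof.
move=> K0; have [M M0 hM] := between_product; have delta0 := delta_ge0 hyp.
have L_ge1 := L1; pose C := 2 * L + 4 * K + 2 * M + 2 * delta.
have C0 : 0 <= C by rewrite /C; lra.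
have LC : 0 <= L * C by rewrite mulr_ge0//; lra.
exists (L * C + L) => [|x p y pxy]; first lra.
have [c [c0 cn gc]] := word_geodesic x y; set n := word_norm _ _ in cn gc.
have [t tn ht] : exists2 t, (t <= n)%N & `|d0 x (c t) - d0 x p| <= 2 * L + 2 * K.
  have [le|lt] := leP (d0 x y) (d0 x p).
    exists n => //; rewrite cn ler0_norm; last lra.
    move: pxy; rewrite /gromov_product (distC hyp p x) => pxy.
    by have := dist_ge0 hyp p y; lra.
  have ext : exists t, d0 x p <= d0 x (c t) by exists n; rewrite cn; lra.
  case: (ex_minnP ext) => t ht mint; have tn : (t <= n)%N.
    by apply: mint; rewrite cn; lra.
  exists t => //; rewrite ger0_norm; last lra.
  case: t ht mint tn => [|t] ht mint tn.
    by move: ht; rewrite c0 (dist_xx hyp); have := dist_ge0 hyp x p; lra.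
  have : d0 x (c t) < d0 x p.
    by rewrite ltNge; apply/negP => /mint; rewrite ltnn.
  have := dist_tri hyp x (c t) (c t.+1).
  have := d0_le (c t) (c t.+1); rewrite gc ?subSnn; last lia.
  by lra.
have xqy : between dS x (c t) y.
  by rewrite -c0 -cn; apply: geodesic_between gc tn.
exists (c t) => //; apply: le_trans (d0_ge _ _) _; rewrite lerD2r ler_pM2l; last lra.
have := hM _ _ _ xqy; move: pxy ht; rewrite /gromov_product ler_norml /C.
have := dist_hyp hyp p x (c t) y; rewrite !(distC hyp _ x).
by case; lra.
Qed.

(** At a point of one side, the four-point condition of [d0] makes the ends of one
    of the other two sides appear in opposite directions. *)
Lemma slim_triangles : exists2 C : R, 0 <= C & forall x y z p, between dS x p z ->
  exists2 q, dS p q <= C & between dS x q y \/ between dS y q z.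
Proof.
have [M M0 hM] := between_product; have delta0 := delta_ge0 hyp.
have [C C0 hC] := @near_geodesic (M + delta) ltac:(lra).
exists C => // x y z p /hM pxz.
case: (gp_hyp hyp p x y z) => h.
  have [|q xqy pq] := hC x p y; first lra.
  by exists q => //; left.
have [|q xqy pq] := hC y p z; first lra.
by exists q => //; right.
Qed.

(** Where the geodesic from [x] to [z] stops being close to the one from [x] to [w],
    it is close to both other sides of the triangle, hence as close to [w] as the
    Gromov product allows. *)
Lemma product_near_geodesic : exists2 C : R, 0 <= C & forall w x z,
  exists2 p, between dS x p z & dS w p <= gromov_product dS w x z + C.
Proof.
have [C C0 hC] := slim_triangles; exists (2 * C + 1) => [|w x z]; first lra.
have [dxx dge dC dtri] := pm.
have [c [c0 cn gc]] := word_geodesic x z; set n := word_norm _ _ in cn gc.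
have bt t : (t <= n)%N -> between dS x (c t) z.
  by move=> tn; rewrite -c0 -cn; apply: geodesic_between.
pose P t := (t <= n)%N && `[< exists2 q, dS (c t) q <= C & between dS x q w >].
have P0 : exists t, P t.
  exists 0%N; apply/andP; split=> //; apply/asboolP; exists x.
    by rewrite c0 dxx.
  by rewrite /between dxx add0r.
have Pn t : P t -> (t <= n)%N by case/andP.
case: (ex_maxnP P0 Pn) => t /andP[tn /asboolP[q1 pq1 xqw]] maxt.
exists (c t); first exact: bt.
have [q2 pq2 wqz] : exists2 q, dS (c t) q <= C + 1 & between dS w q z.
  have [tn'|nt] := ltnP t n; last first.
    have -> : t = n by lia.
    by exists z; rewrite ?cn ?dxx /between ?dxx; lra.
  have [q pq [xqw'|wqz]] := hC x w z (c t.+1) (bt _ tn').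
    have : P t.+1 by rewrite /P tn'; apply/asboolP; exists q.
    by move=> /maxt; rewrite ltnn.
  exists q => //; have := dtri (c t) (c t.+1) q.
  by rewrite (gc t t.+1) ?subSnn; [lra|lia].
have := bt t tn; move: xqw wqz; rewrite /between /gromov_product.
rewrite (dC x w); have := dtri x q1 (c t); have := dtri (c t) q1 w.
have := dtri w q2 (c t); have := dtri (c t) q2 z.
rewrite (dC q1 (c t)) (dC q2 (c t)) (dC (c t) w).
by lra.
Qed.

Lemma gp_le_between w x q y : between dS x q y -> gromov_product dS w x y <= dS w q.
Proof.
have [dxx dge dC dtri] := pm.
have := dtri w q x; have := dtri w q y; rewrite (dC q x) /between /gromov_product.
by lra.
Qed.

(** With slim triangles, the product is the distance to a geodesic, and this
    distance satisfies the four-point condition. *)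
Lemma word_hyperbolic_at : exists delta', hyperbolic_at delta' dS.
Proof.
have [C1 C10 hC1] := slim_triangles; have [C2 C20 hC2] := product_near_geodesic.
have [dxx dge dC dtri] := pm.
exists (C1 + C2); split=> [//|w x y z].
have [p xpz wp] := hC2 w x z; have [q pq xqz] := hC1 x y z p xpz.
have := dtri w p q; rewrite minEle.
by case: xqz => /(gp_le_between w); case: ifP => /=; lra.
Qed.

(** The point of a word geodesic that is nearest to [w] bounds the word product from
    below and, since it sees [x] and [y] in opposite directions for [d0], the
    product of [d0] from above. *)
Lemma product_comparison : exists2 K : R, 0 <= K & forall w x y,
  gromov_product d0 w x y <= K * gromov_product dS w x y + K.
Proof.
have [M M0 hM] := between_product; have [C C0 hC] := product_near_geodesic.
have L_ge1 := L1; have LC : 0 <= L * C by rewrite mulr_ge0//; lra.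
exists (L * C + L + M) => [|w x y]; first by lra.
have [p xpy wp] := hC w x y; have := hM x p y xpy.
have gS : 0 <= gromov_product dS w x y.
  have [dxx dge dC dtri] := pm; have := dtri x w y.
  by rewrite (dC x w) /gromov_product; lra.
have h1 : L * dS w p <= L * (gromov_product dS w x y + C) by rewrite ler_wpM2l//; lra.
have h2 : 0 <= (L * C + M) * gromov_product dS w x y by rewrite mulr_ge0//; lra.
have h3 : gromov_product d0 w x y <= d0 w p + gromov_product d0 p x y.
  have := dist_tri hyp w p x; have := dist_tri hyp w p y.
  by rewrite /gromov_product; lra.
by have := d0_le w p; lra.
Qed.

End QuasiIsometry.

End WordGeodesics.

Section HyperbolicGroup.
Context {R : realType} {G : groupType} {S : set G}.
Hypotheses (finS : finite_set S) (genS : generates S).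
Implicit Types (d : G -> G -> R).
Local Notation dS := (word_dist S : G -> G -> R).

Lemma word_dist_le (S' : set G) : finite_set S' -> generates S' ->
  exists2 A : R, 1 <= A & forall x y : G,
    word_dist S x y <= A * word_dist S' x y :> R.
Proof.
move=> finS' genS'; have [A hA] := word_norm_le_word_norm genS genS' finS'.
exists (A.+1)%:R => [|x y]; first by rewrite ler1n.
rewrite !word_distE -natrM ler_nat; apply: leq_trans (hA _) _.
by rewrite leq_mul2r leqnSn orbT.
Qed.

Lemma word_hyperbolic : hyperbolic_group R G -> exists delta, hyperbolic_at delta dS.
Proof.
move=> [S' [finS' genS' [delta _ hypS']]].
have hyp : hyperbolic_at delta (word_dist S' : G -> G -> R).
  by split=> //; apply: word_dist_pseudo_metric.
have [A A1 hA] := word_dist_le finS' genS'.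
have [B hB] := word_norm_le_word_norm genS' genS finS.
have d'0 x y : 0 <= word_dist S' x y :> R by rewrite ler0n.
have d0 x y : 0 <= dS x y by rewrite ler0n.
have B0 : 0 <= B%:R :> R by [].
apply: (word_hyperbolic_at genS (L := A + B%:R) hyp) => [|x y|x y]; first lra.
  have : word_dist S' x y <= B%:R * dS x y by rewrite !word_distE -natrM ler_nat.
  by have := mulr_ge0 (le_trans ler01 A1) (d0 x y); lra.
by have := hA x y; have := mulr_ge0 B0 (d'0 x y); lra.
Qed.

Lemma in_D_product d : in_D d -> exists2 K : R, 0 <= K & forall w x y,
  gromov_product d w x y <= K * gromov_product dS w x y + K.
Proof.
move=> [[pmd _] _ [delta _ hypd] [S' [finS' genS' [L [C [L1 C0 qi]]]]]].
have hyp : hyperbolic_at delta d by split.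
have [A A1 hA] := word_dist_le finS' genS'.
have [B hB] := word_norm_le_word_norm genS' genS finS.
have d'0 x y : 0 <= word_dist S' x y :> R by rewrite ler0n.
have d0 x y : 0 <= dS x y by rewrite ler0n.
have B0 : 0 <= B%:R :> R by [].
have L0 : 0 < L by lra.
have ALC : 0 <= A * L * C by rewrite !mulr_ge0//; lra.
have AL : L <= A * L by rewrite ler_peMl//; lra.
have LB : 0 <= L * B%:R by rewrite mulr_ge0//; lra.
apply: (product_comparison genS (L := A * L + A * L * C + L * B%:R + C) hyp).
- by lra.
- move=> x y; have /andP[_] := qi x y.
  have : L * word_dist S' x y <= L * (B%:R * dS x y).
    by rewrite ler_pM2l// !word_distE -natrM ler_nat.
  have : 0 <= (A * L + A * L * C + C) * dS x y by rewrite mulr_ge0//; lra.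
  by lra.
- move=> x y; have /andP[h _] := qi x y.
  have h1 : word_dist S' x y <= L * (d x y + C).
    have : L * (L^-1 * word_dist S' x y) <= L * (d x y + C) by rewrite ler_pM2l//; lra.
    by rewrite mulrA divff ?gt_eqF// mul1r.
  have : A * word_dist S' x y <= A * (L * (d x y + C)) by rewrite ler_pM2l//; lra.
  have : 0 <= (A * L * C + L * B%:R + C) * d x y.
    by rewrite mulr_ge0//; [lra|exact: dist_ge0 hyp _ _].
  by have := hA x y; lra.
Qed.

Lemma in_Dbar_product d : in_Dbar d -> exists2 K : R, 0 <= K & forall x y,
  gromov_product d 1%g x y <= K * gromov_product dS 1%g x y + K.
Proof.
move=> [_ _ _ [l [d0 [l0 /in_D_product[K K0 hK] hl]]]].
have lK : 0 <= l * K by rewrite mulr_ge0//; lra.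
exists (l * K + l) => [|x y]; first lra.
have gS : 0 <= gromov_product dS 1%g x y.
  have [dxx dge dC dtri] := @word_dist_pseudo_metric R G S genS.
  by have := dtri x 1%g y; rewrite (dC x 1%g) /gromov_product; lra.
have : l * gromov_product d0 1%g x y <= l * (K * gromov_product dS 1%g x y + K).
  by rewrite ler_pM2l.
have : 0 <= l * gromov_product dS 1%g x y by rewrite mulr_ge0//; lra.
by have := hl x y; lra.
Qed.

End HyperbolicGroup.
(** * Geodesic rays and sequences converging to infinity *)

Section Rays.
Context {R : realType} {G : groupType} {S : set G}.
Hypotheses (finS : finite_set S) (genS : generates S).
Implicit Types (g h x y z : G) (s t u c : nat -> G).
Local Notation dS := (word_dist S : G -> G -> R).
Local Notation nm := (word_norm S).
Local Notation gp := (gromov_product dS 1%g).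

Lemma gp_translate w x y :
  gromov_product dS w x y = gp (w^-1 * x)%g (w^-1 * y)%g.
Proof.
have li := @word_dist_left_invariant R G S.
by rewrite /gromov_product -!(li w^-1%g w) -(li w^-1%g x y) mulVg.
Qed.

Definition geodesic_ray c : Prop := c 0%N = 1%g /\ forall n, geodesic dS n c.

Lemma ray_dist c i j : geodesic_ray c -> (i <= j)%N -> dS (c i) (c j) = (j - i)%:R.
Proof. by move=> [_ gc] ij; apply: (gc j); rewrite ij leqnn. Qed.

Lemma ray_norm c n : geodesic_ray c -> nm (c n) = n.
Proof.
move=> rc; have := ray_dist rc (leq0n n); rewrite rc.1 word_dist1 subn0.
by move/eqP; rewrite eqr_nat => /eqP.
Qed.

Lemma ray_gp c i j : geodesic_ray c -> (i <= j)%N -> gp (c i) (c j) = i%:R.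
Proof.
move=> rc ij; rewrite /gromov_product !word_dist1 !ray_norm// ray_dist//.
by rewrite natrB//; lra.
Qed.

Lemma finite_pigeonhole (T : choiceType) (A : set T) (Q : T -> nat -> Prop) :
  finite_set A -> (forall N, exists n p, [/\ (N <= n)%N, A p & Q p n]) ->
  exists2 p, A p & forall N, exists2 n, (N <= n)%N & Q p n.
Proof.
move=> finA hQ; apply: contrapT => hn.
have bd p : exists N, A p -> forall n, (N <= n)%N -> ~ Q p n.
  have [Ap|nAp] := pselect (A p); last by exists 0%N.
  apply: contrapT => hN; apply: hn; exists p => // N.
  apply: contrapT => hNn; apply: hN; exists N => _ n Nn Qpn; apply: hNn.
  by exists n.
have [f hf] := choice bd.
have [n [p [Mn Ap Qpn]]] := hQ (\max_(q <- fset_set A) f q)%N.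
apply: (hf p Ap n) Qpn; apply: leq_trans Mn.
by apply: leq_bigmax_seq => //; rewrite in_fset_set// inE.
Qed.

(** Koenig's lemma: balls are finite, so at each point of the ray under
    construction infinitely many of the segments from 1 to [s n] agree on some
    next step. *)
Lemma koenig_ray s : (forall m, exists N, forall n, (N <= n)%N -> (m <= nm (s n))%N) ->
  exists2 c, geodesic_ray c & forall m N, exists2 n, (N <= n)%N &
    (m + nm ((c m)^-1 * s n)%g)%N = nm (s n).
Proof.
move=> sinf.
pose I m g := nm g = m /\ forall N, exists2 n, (N <= n)%N &
  (m + nm (g^-1 * s n)%g)%N = nm (s n).
have next (mg : nat * G) : exists h, I mg.1 mg.2 ->
    I mg.1.+1 h /\ (nm (mg.2^-1 * h)%g <= 1)%N.
  case: mg => m g /=.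
  have [[gm hg]|nI] := pselect (I m g); last by exists 1%g.
  have [p /= p1 hp] : exists2 p, (nm p <= 1)%N & forall N, exists2 n, (N <= n)%N &
      (m.+1 + nm ((g * p)^-1 * s n)%g)%N = nm (s n).
    apply: (finite_pigeonhole (word_norm_finite genS 1 finS)) => N.
    have [N' hN'] := sinf m.+1.
    have [n Nn hn] := hg (maxn N N'); have := hN' n ltac:(lia).
    move=> mn; have [p [p1 hp]] := @word_norm_split _ _ genS (g^-1 * s n)%g 1 ltac:(lia).
    exists n, p; split; [lia|by rewrite /= p1|].
    by rewrite invgM -mulgA hp; lia.
  exists (g * p)%g => _; rewrite mulKg; split=> //; split=> //.
  have [n _ hn] := hp 0%N; have := word_normM genS g p.
  have := word_normM genS (g * p)%g ((g * p)^-1 * s n)%g; rewrite mulVKg.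
  by lia.
have [f hf] := choice next.
pose c := nat_rect (fun=> G) 1%g (fun m g => f (m, g)).
have Ic m : I m (c m).
  elim: m => [|m ih]; last by have [] := hf (m, c m) ih.
  split; first exact: word_norm1.
  by move=> N; exists N => //; rewrite invg1 mul1g.
exists c; last by move=> m; have [] := Ic m.
split=> // n; apply: geodesic_of_steps.
- exact: word_dist_pseudo_metric.
- by rewrite word_dist1; have [-> _] := Ic n.
- move=> i _; rewrite word_distE lern1.
  by have [_] := hf (i, c i) (Ic i).
Qed.

Variable delta : R.
Hypothesis hyp : hyperbolic_at delta dS.

Lemma gromov_equivP s t : gromov_equiv dS s t <->
  forall A : R, exists N, forall m n, (N <= m)%N -> (N <= n)%N -> A <= gp (s m) (t n).
Proof.
split=> [h A|h].
  have /cvgryPge/(_ A)[[P Q] /= [[N1 _ P1] [N2 _ Q2]] PQ] := h.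
  exists (maxn N1 N2) => m n; rewrite !geq_max => /andP[m1 m2] /andP[n1 n2].
  by apply: (PQ (m, n)); split=> /=; [exact: P1|exact: Q2].
apply/cvgryPge => A; have [N hN] := h A.
exists ([set n | (N <= n)%N], [set n | (N <= n)%N]); first by split; exists N.
by move=> [m n] /= [Nm Nn]; exact: hN.
Qed.

Lemma gromov_equiv_sym s t : gromov_equiv dS s t -> gromov_equiv dS t s.
Proof.
move=> /gromov_equivP h; apply/gromov_equivP => A; have [N hN] := h A.
by exists N => m n Nm Nn; rewrite (gpC hyp); exact: hN.
Qed.

Lemma gromov_equiv_trans s t u :
  gromov_equiv dS s t -> gromov_equiv dS t u -> gromov_equiv dS s u.
Proof.
move=> /gromov_equivP st /gromov_equivP tu; apply/gromov_equivP => A.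
have [N hN] := st (A + delta); have [M hM] := tu (A + delta).
exists (maxn N M) => m n hm hn.
have h1 := hN m (maxn N M) ltac:(lia) ltac:(lia).
have h2 := hM (maxn N M) n ltac:(lia) ltac:(lia).
by case: (gp_hyp hyp 1%g (s m) (t (maxn N M)) (u n)); lra.
Qed.

Lemma gromov_equiv_refl s t : gromov_equiv dS s t -> gromov_equiv dS s s.
Proof. by move=> st; apply: gromov_equiv_trans st (gromov_equiv_sym st). Qed.

Lemma gp_mul g x y : gp x y - (nm g)%:R <= gp (g * x)%g (g * y)%g.
Proof.
have -> : gp (g * x)%g (g * y)%g = gromov_product dS g^-1%g x y.
  by rewrite [RHS]gp_translate invgK.
have := dist_tri hyp 1%g g^-1%g x; have := dist_tri hyp 1%g g^-1%g y.
by rewrite (word_dist1 g^-1%g) (word_normV genS) /gromov_product; lra.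
Qed.

Lemma gromov_equiv_mul g s t : gromov_equiv dS s t ->
  gromov_equiv dS (fun n => g * s n)%g (fun n => g * t n)%g.
Proof.
move=> /gromov_equivP h; apply/gromov_equivP => A; have [N hN] := h (A + (nm g)%:R).
exists N => m n Nm Nn; have := hN m n Nm Nn; have := gp_mul g (s m) (t n).
by lra.
Qed.

Lemma gromov_equiv_close s t (B : R) : gromov_equiv dS s s ->
  (forall n, dS (s n) (t n) <= B) -> gromov_equiv dS s t.
Proof.
move=> /gromov_equivP ss st; apply/gromov_equivP => A.
have [N hN] := ss (A + B); exists N => m n Nm Nn; have := hN m n Nm Nn.
by have := gp_lip hyp 1%g (s m) (s n) (t n); have := st n; lra.
Qed.

(** A single large product of far terms propagates, by the four-point condition, to
    all products of far terms. *)
Lemma not_gromov_equiv s t : gromov_equiv dS s s -> gromov_equiv dS t t ->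
  ~ gromov_equiv dS s t ->
  exists B : R, exists N, forall m n, (N <= m)%N -> (N <= n)%N -> gp (s m) (t n) <= B.
Proof.
move=> /gromov_equivP ss /gromov_equivP tt nst; apply: contrapT => nb; apply: nst.
apply/gromov_equivP => A; have [N hN] := ss (A + 2 * delta).
have [M hM] := tt (A + 2 * delta); exists (maxn N M) => m n hm hn.
have [[m' [n' [hm' hn' hA]]]|hn'] := pselect (exists m' n',
    [/\ (maxn N M <= m')%N, (maxn N M <= n')%N & A + 2 * delta < gp (s m') (t n')]).
  have h1 := hN m m' ltac:(lia) ltac:(lia); have h2 := hM n' n ltac:(lia) ltac:(lia).
  have := delta_ge0 hyp; case: (gp_hyp hyp 1%g (s m) (s m') (t n)) => h3; first lra.
  by case: (gp_hyp hyp 1%g (s m') (t n') (t n)) => h4; lra.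
exfalso; apply: nb; exists (A + 2 * delta), (maxn N M) => m' n' hm' hn''.
by rewrite leNgt; apply/negP => hA; apply: hn'; exists m', n'.
Qed.

Lemma ray_gromov c : geodesic_ray c -> gromov_equiv dS c c.
Proof.
move=> rc; apply/gromov_equivP => A; exists (Num.truncn A).+1 => m n hm hn.
have hA := ltW (truncnS_gt A).
have [mn|mn] := leqP m n; last rewrite (gpC hyp).
  by rewrite ray_gp//; apply: le_trans hA _; rewrite ler_nat.
by rewrite ray_gp//; [apply: le_trans hA _; rewrite ler_nat|lia].
Qed.

Lemma gromov_norm s : gromov_equiv dS s s ->
  forall m, exists N, forall n, (N <= n)%N -> (m <= nm (s n))%N.
Proof.
move=> /gromov_equivP ss m; have [N hN] := ss m%:R; exists N => n Nn.
rewrite -(ler_nat R) -word_dist1; apply: le_trans (hN n n Nn Nn) _.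
by rewrite (gp_xx hyp).
Qed.

Lemma gp_norm_eq (m : nat) g x : nm g = m -> (m + nm (g^-1 * x))%N = nm x ->
  gp g x = m%:R.
Proof.
move=> gm gx; rewrite /gromov_product !word_dist1 word_distE -gx gm natrD.
by lra.
Qed.

Lemma ray_of_gromov s : gromov_equiv dS s s ->
  exists2 c, geodesic_ray c & gromov_equiv dS c s.
Proof.
move=> ss; have [c rc hc] := koenig_ray (gromov_norm ss); exists c => //.
apply/gromov_equivP => A; have /gromov_equivP/(_ (A + delta))[N hN] := ss.
exists (maxn N (Num.truncn (A + delta)).+1) => m n hm hn.
have [k Nk /gp_norm_eq gk] := hc m N.
have := gk (ray_norm _ rc); have := hN k n Nk ltac:(lia).
have : A + delta <= m%:R.
  by apply: le_trans (ltW (truncnS_gt _)) _; rewrite ler_nat (leq_trans _ hm)// leq_maxr.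
by case: (gp_hyp hyp 1%g (c m) (s k) (s n)); lra.
Qed.

Lemma rays_close c c' n N N' : geodesic_ray c -> geodesic_ray c' ->
  (n <= N)%N -> (n <= N')%N -> n%:R <= gp (c N) (c' N') ->
  dS (c n) (c' n) <= 4 * delta.
Proof.
move=> rc rc' nN nN' h.
have h1 := ray_gp rc nN; have := ray_gp rc' nN'; rewrite (gpC hyp) => h2.
suff : n%:R - 2 * delta <= gp (c n) (c' n).
  by rewrite /gromov_product !word_dist1 !ray_norm//; lra.
have := delta_ge0 hyp.
case: (gp_hyp hyp 1%g (c n) (c N) (c' n)) => h3; first lra.
by case: (gp_hyp hyp 1%g (c N) (c' N') (c' n)) => h4; lra.
Qed.

Lemma equiv_rays_close c c' n : geodesic_ray c -> geodesic_ray c' ->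
  gromov_equiv dS c c' -> dS (c n) (c' n) <= 4 * delta.
Proof.
move=> rc rc' /gromov_equivP/(_ n%:R)[N hN].
by apply: (@rays_close c c' n (maxn N n) (maxn N n)) => //; [lia|lia|]; apply: hN; lia.
Qed.

Lemma ray_near c g N : geodesic_ray c -> (nm g <= N)%N ->
  dS g (c (nm g)) <= 2 * gromov_product dS g 1%g (c N) + 2 * delta.
Proof.
move=> rc gN; have := dist_hyp hyp g 1%g (c (nm g)) (c N).
have := gp_ge0 hyp g 1%g (c N).
rewrite /gromov_product (distC hyp g 1%g) !word_dist1 !ray_norm// ray_dist//.
rewrite natrB//.
by move=> h1 [] h2; lra.
Qed.

End Rays.
(** * Stabilizers of points at infinity *)

Section Stabilizer.
Context {R : realType} {G : groupType} {S : set G}.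
Hypotheses (finS : finite_set S) (genS : generates S).
Implicit Types (g h x y z : G) (s t u c : nat -> G) (b : R).
Local Notation dS := (word_dist S : G -> G -> R).
Local Notation nm := (word_norm S).
Local Notation gp := (gromov_product dS 1%g).
Variable delta : R.
Hypothesis hyp : hyperbolic_at delta dS.

(** [b] is the value at [g^-1] of the Busemann function of the ray [c]. *)
Definition busemann_value c g b : Prop :=
  exists n0, forall n, (n0 <= n)%N -> (nm (g * c n)%g)%:R = n%:R + b.

Lemma busemann_value_exists c g : geodesic_ray (R := R) (S := S) c ->
  exists b, busemann_value c g b.
Proof.
move=> rc; pose v n := (nm (g * c n)%g + nm g - n)%N.
have ge n : (n <= nm (g * c n)%g + nm g)%N.
  have := word_normM genS g^-1%g (g * c n)%g.
  by rewrite mulKg (ray_norm _ rc) (word_normV genS); lia.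
have step n : (v n.+1 <= v n)%N.
  have := word_normM genS (g * c n)%g ((c n)^-1 * c n.+1)%g.
  have -> : (g * c n * ((c n)^-1 * c n.+1) = g * c n.+1)%g by rewrite -mulgA mulVKg.
  have := ray_dist rc (leqnSn n); rewrite word_distE subSnn => /eqP.
  by rewrite eqr_nat => /eqP ->; rewrite /v; lia.
have mono n m : (n <= m)%N -> (v m <= v n)%N.
  by move/subnKC <-; elim: (m - n)%N => [|k ih]; rewrite ?addn0// addnS (leq_trans (step _)).
have exv : exists k, `[< exists n, v n = k >] by exists (v 0%N); apply/asboolP; exists 0%N.
case: (ex_minnP exv) => k /asboolP[n0 vk] mink.
exists (k%:R - (nm g)%:R), n0 => n n0n.
have vn : v n = k.
  apply/eqP; rewrite eqn_leq; apply/andP; split; first by rewrite -vk mono.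
  by apply: mink; apply/asboolP; exists n.
have : (nm (g * c n)%g + nm g)%:R = (n + k)%:R :> R.
  by congr (_%:R); have := ge n; move: vn; rewrite /v; lia.
by rewrite !natrD; lra.
Qed.

Section FixedRay.
Variable c : nat -> G.
Hypothesis rc : geodesic_ray (R := R) (S := S) c.

Definition fixes g : Prop := gromov_equiv dS (fun n => g * c n)%g c.

Lemma fixes1 : fixes 1%g.
Proof.
apply/(gromov_equivP _ _) => A; have /gromov_equivP/(_ A)[N hN] := ray_gromov hyp rc.
by exists N => m n Nm Nn; rewrite mul1g; exact: hN.
Qed.

Lemma fixesM g h : fixes g -> fixes h -> fixes (g * h)%g.
Proof.
rewrite /fixes => fg /(gromov_equiv_mul genS hyp g) fh.
have := gromov_equiv_trans hyp fh fg.
by under [fun n => (g * h * c n)%g]eq_fun do rewrite -mulgA.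
Qed.

Lemma fixesV g : fixes g -> fixes g^-1%g.
Proof.
rewrite /fixes => /(gromov_equiv_mul genS hyp g^-1%g) fg.
apply: (gromov_equiv_sym hyp); move: fg.
by under [X in gromov_equiv _ X _]eq_fun do rewrite mulKg.
Qed.

(** The ray [g * c] is eventually geodesic as seen from 1, so its far points lie on
    the way from 1 to the common end, at the distance that the Busemann value
    prescribes. *)
Lemma fixes_shift g b : fixes g -> busemann_value c g b ->
  exists n0, forall n m, (n0 <= n)%N -> m%:R = n%:R + b ->
    dS (g * c n)%g (c m) <= 4 * delta.
Proof.
move=> /gromov_equivP fg [n0 hb]; exists n0 => n m n0n mE.
have qm : (nm (g * c n)%g)%:R = m%:R :> R by rewrite hb// mE.
have [N hN] := fg m%:R; pose M := maxn N (maxn n m).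
have h1 : gp (g * c n)%g (g * c M)%g = m%:R.
  rewrite /gromov_product !word_dist1 qm (hb M); last by rewrite /M; lia.
  rewrite (@word_dist_left_invariant R G S) (ray_dist rc); last by rewrite /M; lia.
  by rewrite natrB; [lra|rewrite /M; lia].
have h2 := hN M M ltac:(rewrite /M; lia) ltac:(rewrite /M; lia).
have h3 : gp (c m) (c M) = m%:R by rewrite (ray_gp rc)// /M; lia.
suff : m%:R - 2 * delta <= gp (g * c n)%g (c m).
  by rewrite /gromov_product !word_dist1 qm (ray_norm _ rc); lra.
have := delta_ge0 hyp; rewrite (gpC hyp) in h3.
case: (gp_hyp hyp 1%g (g * c n)%g (g * c M)%g (c m)) => h4; first lra.
by case: (gp_hyp hyp 1%g (g * c M)%g (c M) (c m)) => h5; lra.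
Qed.

Lemma busemann_value_morphism g h b b' b'' : fixes h -> busemann_value c g b ->
  busemann_value c h b' -> busemann_value c (g * h)%g b'' ->
  `|b'' - b - b'| <= 4 * delta.
Proof.
move=> fh [n1 hg] hh [n3 hgh]; have [n4 h4] := fixes_shift fh hh.
have [n2 hb'] := hh; have [k hk] : exists k, - b' <= k%:R.
  by exists (Num.truncn (- b')).+1; apply/ltW/truncnS_gt.
pose n := (n1 + n2 + n3 + n4 + k)%N.
have [m mE] : exists m : nat, m%:R = n%:R + b'.
  by exists (nm (h * c n)%g); apply: hb'; rewrite /n; lia.
have n1m : (n1 <= m)%N.
  rewrite -(ler_nat R) mE /n !natrD.
  by have : 0 <= n2%:R + n3%:R + n4%:R :> R by []; lra.
have := h4 n m ltac:(rewrite /n; lia) mE.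
rewrite -(@word_dist_left_invariant R G S g) mulgA.
have := hgh n ltac:(rewrite /n; lia); have := hg m n1m.
rewrite -!(word_dist1 (R := R)) => e1 e2 e3.
have := dist_tri hyp 1%g (g * h * c n)%g (g * c m)%g.
have := dist_tri hyp 1%g (g * c m)%g (g * h * c n)%g.
by rewrite (distC hyp (g * c m)%g) ler_norml; lra.
Qed.

(** Conjugation by a far away point of the ray maps all elements with small
    Busemann value into one ball. *)
Lemma busemann_value_finite (B : R) :
  finite_set [set g | fixes g /\ exists2 b, busemann_value c g b & `|b| <= B].
Proof.
apply: contrapT => inf; pose K := (Num.truncn (4 * delta + B)).+1.
have finK := word_norm_finite genS K finS.
have [X XA cX] := infinite_set_fset (#|` fset_set [set g | (nm g <= K)%N]|).+1 inf.
have far g : exists n0, g \in X -> forall n, (n0 <= n)%N ->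
    dS (c n) (g * c n)%g <= 4 * delta + B.
  have [gX|] := boolP (g \in X); last by exists 0%N.
  have [fg [b hb bB]] := XA g gX; have [n0 hn0] := fixes_shift fg hb.
  have [n1 hn1] := hb; exists (maxn n0 n1) => _ n hn.
  have [m mE hm] : exists2 m : nat, m%:R = n%:R + b & dS (g * c n)%g (c m) <= 4 * delta.
    have mE := hn1 n ltac:(lia).
    by exists (nm (g * c n)%g) => //; apply: hn0 => //; lia.
  rewrite (distC hyp).
  have : dS (c m) (c n) <= B.
    move: bB mE; rewrite ler_norml => /andP[b1 b2] mE.
    have [mn|mn] := leqP m n; last rewrite (distC hyp).
      by rewrite (ray_dist rc)// natrB//; lra.
    by rewrite (ray_dist rc) ?natrB; [lra|lia..].
  have := dist_tri hyp (g * c n)%g (c m) (c n).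
  by lra.
have [f hf] := choice far; pose n := (\max_(g <- X) f g)%N.
pose conj g := ((c n)^-1 * (g * c n))%g.
have conjK g : g \in X -> (nm (conj g) <= K)%N.
  move=> gX; have := hf g gX n; rewrite leq_bigmax_seq// => /(_ isT).
  rewrite word_distE -/(conj g) => h; rewrite -(ler_nat R).
  by apply: le_trans h _; apply/ltW/truncnS_gt.
have sub : ([fset conj g | g in X] `<=` fset_set [set g | (nm g <= K)%N])%fset.
  apply/fsubsetP => _ /imfsetP[g /= gX ->]; rewrite in_fset_set// inE.
  exact: conjK.
have := fsubset_leq_card sub; rewrite card_imfset; last first.
  by move=> g h /mulgI/mulIg.
by move/(leq_trans cX); rewrite ltnn.
Qed.

Lemma nat_crossing (f : nat -> R) (M : R) : f 0%N <= 0 ->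
  (forall k, f k + 1 <= f k.+1 <= f k + M) -> 0 <= M -> exists k, `|f k| <= M.
Proof.
move=> f0 hf M0; have grow k : f 0%N + k%:R <= f k.
  elim: k => [|k ih]; first lra.
  by have /andP[] := hf k; rewrite -natr1; lra.
have ex : exists k, 0 <= f k.
  exists (Num.truncn (- f 0%N)).+1; have := grow (Num.truncn (- f 0%N)).+1.
  by have := truncnS_gt (- f 0%N); lra.
case: (ex_minnP ex) => k fk mink; exists k; rewrite ger0_norm//.
case: k fk mink => [|k] fk mink; first lra.
have : f k < 0 by rewrite ltNge; apply/negP => /mink; rewrite ltnn.
by have /andP[] := hf k; lra.
Qed.

Lemma cyclic_subgroup_mulr g x : cyclic_subgroup g x ->
  cyclic_subgroup g (x * g)%g /\ cyclic_subgroup g (x * g^-1)%g.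
Proof.
move=> [n [->|->]]; split.
- by exists n.+1; left; rewrite expgSr.
- case: n => [|n]; last by exists n; left; rewrite expgSr mulgK.
  by exists 1%N; right; rewrite expg0 expg1 mul1g.
- case: n => [|n]; last by exists n; right; rewrite expgS invgM mulgVK.
  by exists 1%N; left; rewrite expg0 expg1 invg1 mul1g.
- by exists n.+1; right; rewrite expgS invgM.
Qed.

Lemma cyclic_subgroupM g x y : cyclic_subgroup g x -> cyclic_subgroup g y ->
  cyclic_subgroup g (x * y)%g.
Proof.
move=> cx [n [->|->]].
  elim: n => [|n ih]; first by rewrite expg0 mulg1.
  by rewrite expgSr mulgA; have [] := cyclic_subgroup_mulr ih.
elim: n => [|n ih]; first by rewrite expg0 invg1 mulg1.
by rewrite expgS invgM mulgA; have [] := cyclic_subgroup_mulr ih.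
Qed.

Lemma cyclic_subgroupV g x : cyclic_subgroup g x -> cyclic_subgroup g x^-1%g.
Proof. by move=> [n [->|->]]; exists n; [right|left; rewrite invgK]. Qed.

Lemma coset_cyclic_eq g x (t : G) : cyclic_subgroup g t ->
  [set ((x * t) * h)%g | h in cyclic_subgroup g] = [set (x * h)%g | h in cyclic_subgroup g].
Proof.
move=> ct; apply/seteqP; split=> _ [h ch <-].
  by exists (t * h)%g; [exact: cyclic_subgroupM|rewrite mulgA].
exists (t^-1 * h)%g; last by rewrite mulgA mulgK.
by apply: cyclic_subgroupM => //; exact: cyclic_subgroupV.
Qed.

(** The Busemann function is a quasi-morphism with finite fibres on the stabilizer
    of the end of the ray, so a stabilizer of finite index would make the group
    virtually cyclic. *)
Lemma stabilizer_infinite_index (a : seq G) : nonelementary G ->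
  exists x, forall y, y \in a -> ~ fixes (y^-1 * x)%g.
Proof.
move=> ne; apply: contrapT => cov.
have {}cov x : exists2 y, y \in a & fixes (y^-1 * x)%g.
  apply: contrapT => nx; apply: cov; exists x => y ya fy; apply: nx.
  by exists y.
have d0 := delta_ge0 hyp.
have [beta hbeta] := choice (fun g => busemann_value_exists g rc).
have qm g h : fixes h -> `|beta (g * h)%g - beta g - beta h| <= 4 * delta.
  by move=> fh; apply: busemann_value_morphism (hbeta _) (hbeta _) (hbeta _).
have fin B : finite_set [set g | fixes g /\ `|beta g| <= B].
  apply: sub_finite_set (busemann_value_finite B) => g [fg hg]; split=> //.
  by exists (beta g).
have finite_coset g (F : set G) : finite_set F ->
    (forall x, fixes x -> exists2 f, F f & exists2 t, cyclic_subgroup g t & x = (f * t)%g) ->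
    finite_index (cyclic_subgroup g).
  move=> finF hF.
  have finaF := finite_image2 (fun y f => [set (y * f * h)%g | h in cyclic_subgroup g])
    (finite_seq a) finF.
  apply: sub_finite_set finaF => _ [x _ <-].
  have [y ya /hF[f Ff [t ct xE]]] := cov x.
  exists y => //; exists f => //; rewrite -(coset_cyclic_eq _ ct) -mulgA -xE.
  by rewrite mulVKg.
(* an element whose Busemann value is below [- (12 * delta + 1)] has an inverse
   whose value is above [4 * delta + 1], since [`|beta 1| <= 4 * delta] *)
have [g fg bg] : exists2 g, fixes g & 4 * delta + 1 < beta g.
  apply: contrapT => ng; apply: (ne 1%g).
  apply: (finite_coset _ _ (fin (12 * delta + 1))) => x fx.
  exists x; last by exists 1%g; [exists 0%N; left|rewrite mulg1].
  split=> //; rewrite ler_norml; apply/andP; split; last first.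
    rewrite leNgt; apply/negP => h; apply: ng; exists x => //; lra.
  rewrite leNgt; apply/negP => h; apply: ng; exists x^-1%g; first exact: fixesV.
  have := qm 1%g 1%g fixes1; have := qm x^-1%g x fx; rewrite mulVg mulg1.
  by rewrite !ler_norml; lra.
have fgn n : fixes (g ^+ n)%g.
  by elim: n => [|n ih]; [exact: fixes1|rewrite expgS; exact: fixesM].
apply: (ne g); apply: (finite_coset _ _ (fin (beta g + 4 * delta))) => h fh.
have [h0|h0] := leP (beta h) 0.
  have [|||k hk] := @nat_crossing (fun k => beta (h * g ^+ k)%g) (beta g + 4 * delta).
  - by rewrite expg0 mulg1.
  - move=> k; rewrite expgSr mulgA; have := qm (h * g ^+ k)%g g fg.
    by rewrite ler_norml; lra.
  - by lra.
  exists (h * g ^+ k)%g; first by split=> //; exact: fixesM.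
  by exists (g ^- k)%g; [exists k; right|rewrite mulgK].
have [|||k hk] := @nat_crossing (fun k => - beta (h * g ^- k)%g) (beta g + 4 * delta).
- by rewrite expg0 invg1 mulg1; lra.
- move=> k; have := qm (h * g ^- k.+1)%g g fg.
  have -> : (h * g ^- k.+1 * g = h * g ^- k)%g by rewrite expgS invgM -!mulgA mulVg mulg1.
  by rewrite ler_norml; lra.
- by lra.
exists (h * g ^- k)%g; last by exists (g ^+ k)%g; [exists k; left|rewrite mulgVK].
by split; [apply/fixesM/fixesV|rewrite -normrN].
Qed.

(** Choose the elements one after the other, each outside the finitely many cosets
    of the stabilizer that are already met. *)
Lemma orbit_infinite : nonelementary G -> exists a : nat -> G,
  forall i j, (i < j)%N ->
    ~ gromov_equiv dS (fun n => a i * c n)%g (fun n => a j * c n)%g.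
Proof.
move=> ne; have [f hf] := choice (fun a => stabilizer_infinite_index a ne).
pose s n := iter n (fun l => rcons l (f l)) [::].
exists (fun n => f (s n)) => i j ij eq_ij.
have si : f (s i) \in s j.
  move: ij => /subnKC <-; elim: (j - i.+1)%N => [|k ih]; rewrite /= ?addn0 /=.
    by rewrite mem_rcons mem_head.
  by rewrite addnS /= mem_rcons inE ih orbT.
apply: (hf (s j) _ si); have := gromov_equiv_mul genS hyp (f (s i))^-1%g eq_ij.
rewrite /fixes => /(gromov_equiv_sym hyp).
under [X in gromov_equiv _ X _]eq_fun do rewrite mulgA.
by under [X in gromov_equiv _ _ X]eq_fun do rewrite mulKg.
Qed.

End FixedRay.

End Stabilizer.
(** * Ping-pong families and good pairs *)

Section GoodPairs.
Context {R : realType} {G : groupType} {S : set G}.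
Hypotheses (finS : finite_set S) (genS : generates S) (ne : nonelementary G).
Implicit Types (g h x y z a b : G) (c : nat -> G).
Local Notation dS := (word_dist S : G -> G -> R).
Local Notation nm := (word_norm S).
Local Notation gp := (gromov_product dS 1%g).
Variable delta : R.
Hypothesis hyp : hyperbolic_at delta dS.

Lemma exists_ray : exists c, geodesic_ray (R := R) (S := S) c.
Proof.
have long n : exists g, (n <= nm g)%N.
  apply: contrapT => short; apply: (@ne 1%g).
  have finG : finite_set [set: G].
    apply: sub_finite_set (word_norm_finite genS n finS) => g _ /=.
    by rewrite leqNgt; apply/negP => /ltnW ng; apply: short; exists g.
  exact: finite_image.
have [s hs] := choice long.
have [|c rc _] := @koenig_ray R G S finS genS s; last by exists c.
by move=> m; exists m => n mn; apply: leq_trans (hs n).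
Qed.

Lemma initial_bound (f : nat -> R) k : exists2 C : R, 0 <= C &
  forall i, (i < k)%N -> f i <= C.
Proof.
elim: k => [|k [C C0 hC]]; first by exists 0.
exists (C + `|f k|) => [|i]; first by rewrite addr_ge0.
rewrite ltnS leq_eqVlt => /orP[/eqP ->|/hC h].
  by have := ler_norm (f k); lra.
by have := normr_ge0 (f k); lra.
Qed.

Lemma initial_bound2 (P : nat -> nat -> R -> Prop) k :
  (forall i j B B', P i j B -> B <= B' -> P i j B') ->
  (forall i j, exists B, P i j B) ->
  exists2 C : R, 0 <= C & forall i j, (i < k)%N -> (j < k)%N -> P i j C.
Proof.
move=> mono exP.
have [f hf] : exists f : nat -> nat -> R, forall i j, P i j (f i j).
  have [f hf] := choice (fun ij : nat * nat => exP ij.1 ij.2).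
  by exists (fun i j => f (i, j)) => i j; exact: hf (i, j).
have row i : exists C : R, forall j, (j < k)%N -> f i j <= C.
  by have [C _ hC] := initial_bound (f i) k; exists C.
have [r hr] := choice row; have [C C0 hC] := initial_bound r k.
exists C => // i j ik jk; apply: mono (hf i j) _.
by apply: le_trans (hr i j jk) (hC i ik).
Qed.

(** Arbitrarily long elements that point in [k] different directions, as do their
    inverses, with control that does not depend on the length.  Along a ray
    [c], take [u m = c (n m)] whose inverses also converge to infinity; then
    the elements [a i * u m * (b i)^-1] start near translates of the end of
    [u] and their inverses near translates of the end of [u^-1], and there are
    infinitely many such translates. *)
Lemma ping_pong k : exists2 C : R, 0 <= C & forall A : nat, exists f : nat -> G,
  (forall i, (i < k)%N -> (A <= nm (f i))%N) /\
  forall i j, (i < k)%N -> (j < k)%N -> i <> j ->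
    gp (f i) (f j) <= C /\ gp (f i)^-1%g (f j)^-1%g <= C.
Proof.
have d0 := delta_ge0 hyp; have [c rc] := exists_ray.
have [|e re he] := @koenig_ray R G S finS genS (fun n => (c n)^-1%g).
  move=> m; exists m => n mn; rewrite word_normV// (ray_norm _ rc)//.
have /choice[n hn] m : exists n, (m <= n)%N /\
    (m + nm ((e m)^-1 * (c n)^-1)%g)%N = nm (c n)^-1%g.
  by have [n h1 h2] := he m m; exists n.
pose u m := c (n m); pose v m := (c (n m))^-1%g.
have cu : gromov_equiv dS c u.
  apply/(gromov_equivP _ _) => A; exists (Num.truncn A).+1 => m m' hm hm'.
  have hA := ltW (truncnS_gt A); have [hn1 _] := hn m'.
  apply: (le_trans hA); rewrite /u.
  have [mn|mn] := leqP m (n m'); last rewrite (gpC hyp).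
    by rewrite (ray_gp rc)// ler_nat.
  by rewrite (ray_gp rc) ?(ltnW mn)// ler_nat (leq_trans hm' hn1).
have ev : gromov_equiv dS e v.
  have /gromov_equivP ee := ray_gromov hyp re; apply/(gromov_equivP _ _) => A.
  have [N hN] := ee (A + delta); exists (maxn N (Num.truncn (A + delta)).+1) => m m' hm hm'.
  have h1 := hN m m' ltac:(lia) ltac:(lia); have [_ /(gp_norm_eq (ray_norm _ re)) h2] := hn m'.
  have h3 : A + delta <= m'%:R.
    apply: le_trans (ltW (truncnS_gt _)) _; rewrite ler_nat (leq_trans _ hm')//.
    exact: leq_maxr.
  by case: (gp_hyp hyp 1%g (e m) (e m') (v m')); rewrite ?(h2 R); lra.
have translates (r w : nat -> G) (a : nat -> G) : gromov_equiv dS r w ->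
    (forall i j, (i < j)%N ->
      ~ gromov_equiv dS (fun n => a i * r n)%g (fun n => a j * r n)%g) ->
    exists2 C : R, 0 <= C & forall i j, (i < k)%N -> (j < k)%N -> i <> j ->
      exists N, forall m, (N <= m)%N -> gp (a i * w m)%g (a j * w m)%g <= C.
  move=> rw ha.
  have [||C C0 hC] := @initial_bound2 (fun i j C => i <> j ->
      exists N, forall m, (N <= m)%N -> gp (a i * w m)%g (a j * w m)%g <= C) k.
  - move=> i j B B' hB BB' ij; have [N hN] := hB ij; exists N => m Nm.
    by apply: le_trans (hN m Nm) BB'.
  - move=> i j; have [->|ij] := eqVneq i j; first by exists 0.
    have rwi i := gromov_equiv_mul genS hyp (a i) rw.
    have wi i := gromov_equiv_refl hyp (gromov_equiv_sym hyp (rwi i)).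
    have : ~ gromov_equiv dS (fun n => a i * w n)%g (fun n => a j * w n)%g.
      move=> eqw; have eqr : gromov_equiv dS (fun n => a i * r n)%g (fun n => a j * r n)%g.
        apply: (gromov_equiv_trans hyp (rwi i)).
        apply: (gromov_equiv_trans hyp eqw); exact: (gromov_equiv_sym hyp (rwi j)).
      move: ij; rewrite neq_ltn => /orP[/ha//|/ha]; apply.
      exact: (gromov_equiv_sym hyp eqr).
    move=> /(not_gromov_equiv hyp (wi i) (wi j))[B [N hN]].
    by exists B => _; exists N => m Nm; exact: hN.
  by exists C.
have [a /(translates _ u a cu)[C1 C10 hC1]] := orbit_infinite finS genS hyp rc ne.
have [b /(translates _ v b ev)[C2 C20 hC2]] := orbit_infinite finS genS hyp re ne.
have [D D0 hD] := initial_bound (fun i => (nm (a i) + nm (b i))%:R) k.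
exists (C1 + C2 + 2 * D) => [|A]; first lra.
have [N hN] : exists N, forall i j, (i < k)%N -> (j < k)%N -> i <> j ->
    forall m, (N <= m)%N -> gp (a i * u m)%g (a j * u m)%g <= C1 /\
      gp (b i * v m)%g (b j * v m)%g <= C2.
  have [||C C0 hC] := @initial_bound2 (fun i j N => (i < k)%N -> (j < k)%N -> i <> j ->
      forall m, N <= m%:R -> gp (a i * u m)%g (a j * u m)%g <= C1 /\
      gp (b i * v m)%g (b j * v m)%g <= C2) k.
  - by move=> i j B B' hB BB' ik jk ij m Bm; apply: hB => //; lra.
  - move=> i j; have [[[ik jk] ij]|nij] := pselect (((i < k)%N /\ (j < k)%N) /\ i <> j).
      have [N1 hN1] := hC1 i j ik jk ij; have [N2 hN2] := hC2 i j ik jk ij.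
      exists (maxn N1 N2)%:R => _ _ _ m; rewrite ler_nat => hm.
      by split; [apply: hN1|apply: hN2]; lia.
    by exists 0 => ik jk ij; exfalso; apply: nij.
  exists (Num.truncn C).+1 => i j ik jk ij m hm; apply: (hC i j) => //.
  by apply: le_trans (ltW (truncnS_gt _)) _; rewrite ler_nat.
pose m := (N + A + (Num.truncn D).+1)%N.
exists (fun i => a i * u m * (b i)^-1)%g; split=> [i ik|i j ik jk ij].
  have h1 : (nm (a i) + nm (b i) <= (Num.truncn D).+1)%N.
    by rewrite -(ler_nat R); apply: le_trans (hD i ik) (ltW (truncnS_gt D)).
  have := word_normM genS (a i)^-1%g (a i * u m)%g; rewrite mulKg.
  have := word_normM genS (a i * u m * (b i)^-1)%g (b i); rewrite mulgVK.
  rewrite (word_normV genS) {3}/u (ray_norm _ rc); have [] := hn m; rewrite /m.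
  by lia.
have [hu hv] := hN i j ik jk ij m ltac:(rewrite /m; lia).
have ai l : (nm (a l))%:R + (nm (b l))%:R = (nm (a l) + nm (b l))%:R :> R by rewrite natrD.
have Di := hD i ik; have Dj := hD j jk; rewrite -ai in Di; rewrite -ai in Dj.
have nonneg x : 0 <= (nm x)%:R :> R by [].
split.
  have e1 l : dS (a l * u m * (b l)^-1)%g (a l * u m)%g = (nm (b l))%:R.
    by rewrite word_distE invgM mulgVK invgK.
  have := gp_lipl hyp 1%g (a i * u m * (b i)^-1)%g (a j * u m * (b j)^-1)%g (a i * u m)%g.
  have := gp_lip hyp 1%g (a i * u m)%g (a j * u m * (b j)^-1)%g (a j * u m)%g.
  by rewrite !e1; have := nonneg (a i); have := nonneg (a j); lra.
have e1 l : (a l * u m * (b l)^-1)^-1%g = (b l * v m * (a l)^-1)%g.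
  by rewrite !invgM invgK mulgA.
have e2 l : dS (b l * v m * (a l)^-1)%g (b l * v m)%g = (nm (a l))%:R.
  by rewrite word_distE invgM mulgVK invgK.
have := gp_lipl hyp 1%g (b i * v m * (a i)^-1)%g (b j * v m * (a j)^-1)%g (b i * v m)%g.
have := gp_lip hyp 1%g (b i * v m)%g (b j * v m * (a j)^-1)%g (b j * v m)%g.
by rewrite !e1 !e2; have := nonneg (b i); have := nonneg (b j); lra.
Qed.

(** The product [g * y] runs along [g] up to the part that [y] cancels. *)
Lemma gp_mul_left g y : gp (g * y)%g g = (nm g)%:R - gp g^-1%g y.
Proof.
have := gp_ends hyp 1%g g (g * y)%g; rewrite word_dist1 (gpC hyp 1%g g).
by rewrite (gp_translate g) mulg1 mulKg; lra.
Qed.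

Lemma norm_mulE g y :
  (nm (g * y)%g)%:R = (nm g)%:R + (nm y)%:R - 2 * gp g^-1%g y.
Proof.
by rewrite /gromov_product !word_dist1 word_distE invgK (word_normV genS); lra.
Qed.

(** One of four elements avoids one forbidden initial direction and two forbidden
    initial directions of the inverse, since a direction can be too close to at
    most one of them. *)
Lemma connectors : exists M a0 : R, [/\ 0 <= M, 0 <= a0 & forall y1 y2 y3, exists a,
  [/\ (nm a)%:R <= M, 4 * a0 + 4 * delta < (nm a)%:R, gp y1 a <= a0,
      gp y2 a^-1%g <= a0 & gp y3 a^-1%g <= a0]].
Proof.
have d0 := delta_ge0 hyp; have [C C0 hC] := ping_pong 4.
pose a0 := C + delta; have [f [fA hf]] := hC (Num.truncn (4 * a0 + 4 * delta)).+1.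
have [M M0 hM] := initial_bound (fun i => (nm (f i))%:R) 4.
exists M, a0; split=> // [|y1 y2 y3]; first by rewrite /a0; lra.
have one (p : nat -> G) y : (forall i j, (i < 4)%N -> (j < 4)%N -> i <> j ->
    gp (p i) (p j) <= C) -> exists k, forall i, (i < 4)%N -> i <> k -> gp y (p i) <= a0.
  move=> hp; have [[k [k4 hk]]|nk] := pselect (exists k, (k < 4)%N /\ a0 < gp y (p k)).
    exists k => i i4 ik; have := hp i k i4 k4 ik; rewrite leNgt => h.
    apply/negP => hi; move/negP: h; apply; move: hi hk; rewrite /a0 (gpC hyp _ y).
    by case: (gp_hyp hyp 1%g (p i) y (p k)); lra.
  exists 0%N => i i4 _; rewrite leNgt; apply/negP => hi; apply: nk.
  by exists i.
have [k1 hk1] := one f y1 (fun i j i4 j4 ij => (hf i j i4 j4 ij).1).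
have [k2 hk2] := one (fun i => (f i)^-1%g) y2 (fun i j i4 j4 ij => (hf i j i4 j4 ij).2).
have [k3 hk3] := one (fun i => (f i)^-1%g) y3 (fun i j i4 j4 ij => (hf i j i4 j4 ij).2).
have [i [i4 i1 i2 i3]] : exists i, [/\ (i < 4)%N, i <> k1, i <> k2 & i <> k3].
  apply: contrapT => no.
  have sub : {subset iota 0 4 <= [:: k1; k2; k3]}.
    move=> i; rewrite mem_iota add0n => /andP[_ i4]; apply/negPn/negP.
    rewrite !inE !negb_or => /and3P[/eqP i1 /eqP i2 /eqP i3].
    by apply: no; exists i.
  by have := uniq_leq_size (iota_uniq 0 4) sub.
exists (f i); split; [exact: hM| |exact: hk1|exact: hk2|exact: hk3].
by apply: lt_le_trans (truncnS_gt _) _; rewrite ler_nat fA.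
Qed.

(** Such a pair makes the norm of [x] readable from translation lengths, in every
    metric whose Gromov product is controlled: those of [g] and [g'] are their
    norms up to a constant because the two are cyclically reduced, and the norms
    differ by that of [x] because nothing cancels in [g * (x * b)]. *)
Definition good_pair (C : R) x g g' : Prop := exists b,
  [/\ g' = (g * (x * b))%g, (nm b)%:R <= C, gp g^-1%g (x * b)%g <= C,
      gp g g^-1%g <= C & gp g' g'^-1%g <= C].

(** If [h] is long, [h * a] starts like [h] and its inverse starts like [a^-1], and
    these are different directions; if [h] is short, so is [h * a]. *)
Lemma cyclically_reduced h a (a0 : R) : gp h^-1%g a <= a0 -> gp h a^-1%g <= a0 ->
  4 * a0 + 4 * delta < (nm a)%:R ->
  gp (h * a)%g (h * a)^-1%g <= (nm a)%:R + 2 * a0 + 2 * delta.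
Proof.
move=> h1 h2 h3; have d0 := delta_ge0 hyp; have a00 := gp_ge0 hyp 1%g h a^-1%g.
have n0 : 0 <= (nm a)%:R :> R by [].
have e1 : gp (h * a)^-1%g a^-1%g = (nm a)%:R - gp a h^-1%g.
  by rewrite invgM gp_mul_left (word_normV genS) invgK.
have e2 := gp_mul_left h a.
have e3 : gp (h * a)^-1%g h <= a0 + delta.
  move: h1 h2; rewrite (gpC hyp _ h^-1%g) (gpC hyp _ h) => h1 h2.
  case: (gp_hyp hyp 1%g a^-1%g (h * a)^-1%g h); last lra.
  by rewrite (gpC hyp _ a^-1%g (h * a)^-1%g) e1; lra.
case: (gp_hyp hyp 1%g (h * a)^-1%g (h * a)%g h).
  by rewrite (gpC hyp _ (h * a)^-1%g (h * a)%g); lra.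
rewrite e2 => e4; have := gp_lel hyp 1%g (h * a)%g (h * a)^-1%g; rewrite word_dist1.
have := word_normM genS h a; rewrite -(ler_nat R) natrD.
by lra.
Qed.

(** Follow [h] by a connector [a], by [x], and by another connector [b].  Here [a]
    avoids cancellation with [h], with [x], and with [h] again when [h * a] is
    squared; [b] does the same for what precedes it.  The last two conclusions
    place the pair right behind [h], which gives its shadow a definite proportion
    of the shadow of [h]. *)
Lemma good_pairs : exists2 C : R, 0 <= C & forall h x, exists g g',
  [/\ good_pair C x g g', (nm h <= nm g)%N, (nm g < nm g')%N,
      gp h^-1%g (h^-1 * g')%g <= C & (nm (h^-1 * g')%g)%:R <= (nm x)%:R + C].
Proof.
have d0 := delta_ge0 hyp; have [M [a0 [M0 a00 conn]]] := connectors.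
exists (2 * M + 2 * a0 + 2 * delta) => [|h x]; first lra.
have [a [aM aA ha ah ax]] := conn h^-1%g h x; pose g := (h * a)%g.
have [b [bM bA gb bg _]] := conn (g * x)^-1%g (g * x)%g 1%g; pose g' := (g * x * b)%g.
have na : (nm a)%:R - a0 <= gp g^-1%g a^-1%g.
  rewrite /g invgM gp_mul_left (word_normV genS) invgK (gpC hyp _ a).
  by lra.
have gx : gp g^-1%g x <= a0 + delta.
  have := gp_hyp hyp 1%g a^-1%g g^-1%g x.
  by rewrite (gpC hyp _ a^-1%g g^-1%g) (gpC hyp _ a^-1%g x); case; lra.
have close u : gp u (x * b)%g <= gp u x + M.
  have := gp_lip hyp 1%g u (x * b)%g x; rewrite (distC hyp) word_distE mulKg.
  by lra.
have hax : gp h^-1%g (a * x)%g <= a0 + delta.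
  have := gp_mul_left a x; rewrite (gpC hyp _ a^-1%g x).
  by case: (gp_hyp hyp 1%g h^-1%g (a * x)%g a); lra.
have ng := norm_mulE h a; have ngx := norm_mulE g x; have ng' := norm_mulE (g * x)%g b.
have x0 : 0 <= (nm x)%:R :> R by [].
have a_ge0 : 0 <= (nm a)%:R :> R by [].
have hg' : (h^-1 * g' = a * x * b)%g by rewrite /g' /g -!mulgA mulKg.
exists g, g'; split.
- exists b; split; rewrite ?mulgA//; first lra.
  + by have := close g^-1%g; lra.
  + by have := cyclically_reduced ha ah aA; rewrite -/g; lra.
  + by have := cyclically_reduced gb bg bA; rewrite -/g'; lra.
- by rewrite -(ler_nat R) ng; lra.
- by rewrite -(ltr_nat R) ng'; lra.
- rewrite hg'; have := gp_lip hyp 1%g h^-1%g (a * x * b)%g (a * x)%g.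
  by rewrite (distC hyp) word_distE mulKg; lra.
- rewrite hg'; have := word_normM genS (a * x)%g b; have := word_normM genS a x.
  by rewrite -!(ler_nat R) !natrD; lra.
Qed.

(** A connector [f] that is transverse to [y] at both ends turns the direction of
    [y] into its own. *)
Lemma move_away : exists2 C : R, 0 <= C & forall y, exists2 f, (nm f)%:R <= C &
  gp y (f * y)%g <= C.
Proof.
have d0 := delta_ge0 hyp; have [M [a0 [M0 a00 conn]]] := connectors.
exists (M + a0 + delta) => [|y]; first lra.
have [f [fM fA yf fy _]] := conn y y 1%g; exists f; first lra.
have := gp_mul_left f y; rewrite (gpC hyp _ f^-1%g y).
by case: (gp_hyp hyp 1%g y (f * y)%g f); lra.
Qed.

End GoodPairs.
(** * The boundary: topology, action, shadows *)

Section LimitBounds.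
Context {R : realType} {T : choiceType} {X : filteredType T} (F : set (set X)).
Implicit Types (f : X -> \bar R).
Local Open Scope ereal_scope.

Lemma limf_esup_le f (V : set X) b : F V -> (forall x, V x -> f x <= b) ->
  limf_esup f F <= b.
Proof.
move=> FV fb; apply: ge_ereal_inf; exists (ereal_sup (f @` V)); first by exists V.
by apply: ge_ereal_sup => _ [x Vx <-]; exact: fb.
Qed.

Lemma limf_esup_ge {FF : ProperFilter F} f (V : set X) a : F V ->
  (forall x, V x -> a <= f x) -> a <= limf_esup f F.
Proof.
move=> FV fa; apply: le_ereal_inf_tmp => _ [W FW <-].
have [x [Vx Wx]] := filter_ex (filterI FV FW).
by apply: le_trans (fa x Vx) _; apply: ereal_sup_ubound; exists x.
Qed.

Lemma limf_einf_ge f (V : set X) a : F V -> (forall x, V x -> a <= f x) ->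
  a <= limf_einf f F.
Proof.
move=> FV fa; rewrite /limf_einf leeNr; apply: (limf_esup_le FV) => x Vx.
by rewrite leeN2 fa.
Qed.

Lemma limf_einf_gt f a : a < limf_einf f F ->
  exists2 V : set X, F V & forall x, V x -> a < f x.
Proof.
rewrite /limf_einf lteNr => /ereal_inf_lt[_ [V FV <-] hV].
exists V => // x Vx; rewrite -lteN2; apply: le_lt_trans hV.
by apply: ereal_sup_ubound; exists x.
Qed.

End LimitBounds.

Section Boundary.
Context {R : realType} {G : groupType} {S : set G}.
Hypotheses (finS : finite_set S) (genS : generates S) (ne : nonelementary G).
Local Notation dS := (word_dist S : G -> G -> R).
Local Notation nm := (word_norm S).
Local Notation gp := (gromov_product dS 1%g).
Local Notation bd := (boundary dS).
Implicit Types (g h x y z : G) (s t u c : nat -> G) (xi eta zeta : bd).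
Variable delta : R.
Hypothesis hyp : hyperbolic_at delta dS.

Lemma converging_gromov_class xi : exists2 s, gromov_equiv dS s s &
  converging_to xi = gromov_class dS s.
Proof.
case: xi => c /= [[s ss ->]|[ns _]]; first by exists s.
have [c0 rc] := exists_ray (R := R) finS genS ne.
by case: ns; exists c0; rewrite /gromov_sequence; exact: (ray_gromov hyp rc).
Qed.

Lemma converging_equiv xi s t : converging_to xi s -> converging_to xi t ->
  gromov_equiv dS s t.
Proof.
have [u uu ->] := converging_gromov_class xi => -[_ us] [_ ut].
exact: (gromov_equiv_trans hyp (gromov_equiv_sym hyp us) ut).
Qed.

Lemma equiv_converging xi s t : converging_to xi s -> gromov_equiv dS s t ->
  converging_to xi t.
Proof.
have [u uu ->] := converging_gromov_class xi => -[_ us] st.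
split; first exact: (gromov_equiv_refl hyp (gromov_equiv_sym hyp st)).
exact: (gromov_equiv_trans hyp us st).
Qed.

Lemma boundary_point s : gromov_equiv dS s s -> exists xi : bd, converging_to xi s.
Proof.
move=> ss; have h : is_boundary_point dS (gromov_class dS s) by left; exists s.
by exists (Boundary h); split.
Qed.

Lemma converging_ray xi : exists2 c, geodesic_ray (R := R) (S := S) c & converging_to xi c.
Proof.
have [s ss E] := converging_gromov_class xi.
have [c rc cs] := ray_of_gromov finS genS hyp ss; exists c => //; rewrite E.
by split; [exact: (ray_gromov hyp rc)|exact: (gromov_equiv_sym hyp cs)].
Qed.

Lemma converging_act g xi s : converging_to xi s ->
  converging_to (boundary_act g xi) (fun n => g * s n)%g.
Proof.
move=> xis; have ss := converging_equiv xis xis.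
have gss := gromov_equiv_mul genS hyp g ss; have [eta etas] := boundary_point gss.
rewrite /boundary_act; case: xgetP => [zeta _ [t xit zt]|nz].
  apply: equiv_converging zt _; apply: (gromov_equiv_mul genS hyp).
  exact: (converging_equiv xit xis).
by exfalso; apply: (nz eta); exists s.
Qed.

Lemma boundary_product_gt xi eta s t (r : R) : converging_to xi s ->
  converging_to eta t -> (r%:E < boundary_product xi eta)%E ->
  exists N, forall m n, (N <= m)%N -> (N <= n)%N -> r - 2 * delta <= gp (s m) (t n).
Proof.
move=> xis etat /ereal_sup_gt[_ [s' xis' [t' etat' <-]]] /limf_einf_gt[V].
move=> [[P Q] /= [[N1 _ P1] [N2 _ Q2]] PQ] hV.
have /gromov_equivP/(_ r)[N3 hN3] := converging_equiv xis' xis.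
have /gromov_equivP/(_ r)[N4 hN4] := converging_equiv etat' etat.
exists (N1 + N2 + N3 + N4)%N => m n hm hn; pose k := (N1 + N2 + N3 + N4)%N.
have h1 : r < gp (s' k) (t' k).
  rewrite -lte_fin; apply: (hV (k, k)); apply: PQ.
  by split; [apply: P1|apply: Q2] => /=; rewrite /k; lia.
have h2 := hN3 k m ltac:(rewrite /k; lia) ltac:(lia).
have h3 := hN4 k n ltac:(rewrite /k; lia) ltac:(lia); have d0 := delta_ge0 hyp.
rewrite (gpC hyp) in h2; case: (gp_hyp hyp 1%g (s m) (s' k) (t n)) => h4; first lra.
by case: (gp_hyp hyp 1%g (s' k) (t' k) (t n)) => h5; lra.
Qed.

Lemma boundary_product_ge xi eta s t (r : R) N : converging_to xi s ->
  converging_to eta t ->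
  (forall m n, (N <= m)%N -> (N <= n)%N -> r <= gp (s m) (t n)) ->
  (r%:E <= boundary_product xi eta)%E.
Proof.
move=> xis etat hN; apply: le_trans (ereal_sup_ubound _); last first.
  by exists s => //; exists t.
apply: (limf_einf_ge (V := [set n | (N <= n)%N] `*` [set n | (N <= n)%N])).
  by exists ([set n | (N <= n)%N], [set n | (N <= n)%N]) => //; split; exists N.
by move=> [m n] [/= Nm Nn]; rewrite lee_fin hN.
Qed.

(** The sets of the boundary that contain all points with a large product with
    [xi] are neighborhoods of [xi], because the product is a quasi-ultrametric. *)
Lemma nbhs_product xi (A : set bd) (r : R) :
  (forall eta, (r%:E < boundary_product xi eta)%E -> A eta) -> nbhs xi A.
Proof.
move=> hA; have d0 := delta_ge0 hyp.
pose U := [set zeta : bd | exists q : R, forall eta,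
  (q%:E < boundary_product zeta eta)%E -> A eta].
exists U; split; last 2 first.
- by exists r.
- move=> zeta [q]; apply; have [c rc zc] := converging_ray zeta.
  have /gromov_equivP/(_ (q + 1))[N hN] := converging_equiv zc zc.
  apply: lt_le_trans (boundary_product_ge zc zc hN).
  by rewrite lte_fin; lra.
move=> zeta [q hq]; exists (q + 3 * delta + 1) => eta ze; exists (q + 3 * delta + 1).
move=> theta et; apply: hq.
have [c rc zc] := converging_ray zeta; have [c' rc' ec] := converging_ray eta.
have [c'' rc'' tc] := converging_ray theta.
have [N hN] := boundary_product_gt zc ec ze.
have [M hM] := boundary_product_gt ec tc et.
apply: (@lt_le_trans _ _ (q + 1)%:E); first by rewrite lte_fin; lra.
apply: (boundary_product_ge (N := maxn N M) zc tc) => m n hm hn.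
have h1 := hN m (maxn N M) ltac:(lia) ltac:(lia).
have h2 := hM (maxn N M) n ltac:(lia) ltac:(lia).
by case: (gp_hyp hyp 1%g (c m) (c' (maxn N M)) (c'' n)) => h3; lra.
Qed.

Lemma boundary_act_open g (U : set bd) : open U -> open (boundary_act g @^-1` U).
Proof.
move=> oU; rewrite openE => xi /= Ux.
have [r hr] : exists r : R, forall eta, (r%:E < boundary_product (boundary_act g xi) eta)%E ->
  U eta := oU _ Ux.
apply: (@nbhs_product xi _ (r + 2 * delta + (nm g)%:R + 1)) => eta xe /=.
apply: hr; have [c rc xc] := converging_ray xi; have [c' rc' ec] := converging_ray eta.
have [N hN] := boundary_product_gt xc ec xe.
apply: (@lt_le_trans _ _ (r + 1)%:E); first by rewrite lte_fin; lra.
apply: (boundary_product_ge (N := N) (converging_act g xc) (converging_act g ec)).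
by move=> m n hm hn; have := hN m n hm hn; have := gp_mul genS hyp g (c m) (c' n); lra.
Qed.

(** The boundary points seen from 1 in the direction of the ball of radius [r]
    around [g]. *)
Definition shadow g (r : R) : set bd := [set xi | exists c,
  [/\ geodesic_ray (R := R) (S := S) c, converging_to xi c & dS (c (nm g)) g <= r]].

Lemma shadow_le g r r' : r <= r' -> shadow g r `<=` shadow g r'.
Proof. by move=> rr' xi [c [rc xc cg]]; exists c; split=> //; exact: le_trans cg rr'. Qed.

Lemma shadow_ray g r xi c : shadow g r xi -> geodesic_ray (R := R) (S := S) c ->
  converging_to xi c -> dS (c (nm g)) g <= r + 4 * delta.
Proof.
move=> [c' [rc' xc' cg]] rc xc.
have := equiv_rays_close hyp (nm g) rc rc' (converging_equiv xc xc').
by have := dist_tri hyp (c (nm g)) (c' (nm g)) g; lra.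
Qed.

Lemma shadow_interior g r : shadow g r `<=` (shadow g (r + 4 * delta))°.
Proof.
move=> xi [c [rc xc cg]].
apply: (@nbhs_product _ _ ((nm g)%:R + 2 * delta)) => eta xe.
have [c' rc' ec] := converging_ray eta; exists c'; split=> //.
have [N hN] := boundary_product_gt xc ec xe.
have close : dS (c (nm g)) (c' (nm g)) <= 4 * delta.
  apply: (@rays_close _ _ _ _ hyp c c' (nm g) (maxn N (nm g)) (maxn N (nm g))) => //.
  - exact: leq_maxr.
  - exact: leq_maxr.
  - by have := hN (maxn N (nm g)) (maxn N (nm g)) (leq_maxl _ _) (leq_maxl _ _); lra.
by have := dist_tri hyp (c' (nm g)) (c (nm g)) g; rewrite (distC hyp (c' _) (c _)); lra.
Qed.

Lemma shadow_cover xi n : exists2 h, nm h = n & shadow h 0 xi.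
Proof.
have [c rc xc] := converging_ray xi; exists (c n); first exact: (ray_norm _ rc).
by exists c; rewrite (ray_norm _ rc) (dist_xx hyp).
Qed.

Lemma shadow_sub h g r (C : R) : gp h^-1%g (h^-1 * g)%g <= C -> (nm h <= nm g)%N ->
  shadow g r `<=` shadow h (2 * C + 2 * r + 2 * delta).
Proof.
move=> hg nhg xi [c [rc xc cg]]; exists c; split=> //.
have := ray_near hyp rc nhg; rewrite (distC hyp h).
have := gp_lip hyp h 1%g (c (nm g)) g.
by rewrite (gp_translate h 1%g g) mulg1; lra.
Qed.

Lemma shadow_move h h' r (t : R) : nm h = nm h' -> dS h h' <= t ->
  shadow h r `<=` shadow h' (r + t).
Proof.
move=> hh' ht xi [c [rc xc ch]]; exists c; split=> //; rewrite -hh'.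
by have := dist_tri hyp (c (nm h)) h h'; lra.
Qed.

Lemma shadow_overlap h h' r xi : nm h = nm h' -> shadow h r xi -> shadow h' r xi ->
  dS h h' <= 2 * r + 4 * delta.
Proof.
move=> hh' hxi [c [rc xc ch]]; have := shadow_ray hxi rc xc; rewrite hh'.
have := dist_tri hyp h (c (nm h')) h'; rewrite (distC hyp h (c _)).
by lra.
Qed.

Lemma shadow_product h r xi eta : shadow h r xi -> shadow h r eta ->
  (((nm h)%:R - r - 2 * delta)%:E <= boundary_product xi eta)%E.
Proof.
move=> [c [rc xc ch]] [c' [rc' ec ch']]; have d0 := delta_ge0 hyp.
apply: (boundary_product_ge (N := nm h) xc ec) => m n hm hn.
have h1 : (nm h)%:R - r <= gp (c (nm h)) (c' (nm h)).
  have := dist_tri hyp (c (nm h)) h (c' (nm h)); rewrite (distC hyp h).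
  by rewrite /gromov_product !word_dist1 (ray_norm _ rc) (ray_norm _ rc'); lra.
have h2 : gp (c (nm h)) (c m) = (nm h)%:R := ray_gp rc hm.
have h3 : gp (c' (nm h)) (c' n) = (nm h)%:R := ray_gp rc' hn.
have r0 : 0 <= r by apply: le_trans ch; exact: dist_ge0 hyp _ _.
rewrite (gpC hyp) in h2.
case: (gp_hyp hyp 1%g (c m) (c (nm h)) (c' n)) => h4; first lra.
by case: (gp_hyp hyp 1%g (c (nm h)) (c' (nm h)) (c' n)) => h5; lra.
Qed.

(** Seen from [h], the point 1 is in the direction [h^-1]; if the translated
    sequence goes elsewhere, its limit ray from 1 passes near [h]. *)
Lemma act_shadow h s (r : R) zeta : gromov_equiv dS s s ->
  (forall N, exists2 n, (N <= n)%N & gp h^-1%g (s n) <= r) ->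
  converging_to zeta (fun n => h * s n)%g -> shadow h (2 * r + 4 * delta) zeta.
Proof.
move=> ss hs zs; have [c rc zc] := converging_ray zeta; exists c; split=> //.
have /gromov_equivP/(_ (r + delta + (nm h)%:R + 1))[N hN] := converging_equiv zc zs.
have [n Nn hn] := hs N.
have := @ray_near _ _ _ _ hyp c h (maxn N (nm h)) rc (leq_maxr _ _).
rewrite (distC hyp h) (gp_translate h 1%g) mulg1.
have := hN (maxn N (nm h)) n (leq_maxl _ _) Nn.
have := gp_mul genS hyp h^-1%g (c (maxn N (nm h))) (h * s n)%g.
rewrite mulKg (word_normV genS).
have := gp_hyp hyp 1%g h^-1%g (h^-1 * c (maxn N (nm h)))%g (s n).
by move=> [] h1 h2 h3 h4; lra.
Qed.

(** If both [xi] and [f xi] were in the direction of [h^-1], then so would be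
    [f * h^-1], which [move_away] excludes for a suitable [f]. *)
Lemma shadow_covers_twice : exists2 C : R, 0 <= C & forall h, exists2 f, (nm f)%:R <= C &
  forall xi, shadow h C (boundary_act h xi) \/ shadow h C (boundary_act (h * f)%g xi).
Proof.
have d0 := delta_ge0 hyp; have [C C0 hC] := move_away finS genS ne hyp.
pose r := 2 * C + delta; exists (2 * r + 4 * delta); first by rewrite /r; lra.
move=> h; have [f fC hf] := hC h^-1%g; exists f => [|xi]; first by rewrite /r; lra.
have [c rc xc] := converging_ray xi; have cc := ray_gromov hyp rc.
have [h1|] := pselect (forall N, exists2 n, (N <= n)%N & gp h^-1%g (c n) <= r).
  by left; exact: (act_shadow cc h1 (converging_act h xc)).
move=> /existsNP[N hN]; right.
apply: (act_shadow (s := fun n => f * c n)%g).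
- exact: (gromov_equiv_mul genS hyp f cc).
- move=> M; exists (maxn N M); first exact: leq_maxr.
  rewrite leNgt; apply/negP => h2; apply: hN; exists (maxn N M); first exact: leq_maxl.
  rewrite leNgt; apply/negP => h3.
  have := gp_mul genS hyp f h^-1%g (c (maxn N M)).
  rewrite (gpC hyp _ (f * h^-1)%g).
  case: (gp_hyp hyp 1%g h^-1%g (f * c (maxn N M))%g (f * h^-1)%g) => h4 h5;
    by move: h2 h3; rewrite /r; lra.
- have := converging_act (h * f)%g xc.
  by under [X in converging_to _ X]eq_fun do rewrite -mulgA.
Qed.

(** Points that converge into the shadow of [h] are reached from 1 through a
    neighborhood of [h], so they are closer to [h] than to 1 by almost the norm
    of [h]. *)
Lemma busemann_shadow h f r xi : shadow h r xi ->
  - (nm h)%:R - (nm f)%:R <= fine (busemann (h * f)%g xi)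
    <= - (nm h)%:R + (2 * r + 4 * delta + (nm f)%:R).
Proof.
move=> [c [rc xc ch]].
have bounds s : converging_to xi s -> exists N, forall n, (N <= n)%N ->
    - (nm h)%:R - (nm f)%:R <= dS (h * f)%g (s n) - dS 1%g (s n)
      <= - (nm h)%:R + (2 * r + 4 * delta + (nm f)%:R).
  move=> xs; have /gromov_equivP/(_ (nm h)%:R)[N hN] := converging_equiv xc xs.
  exists N => n Nn; have := hN (maxn N (nm h)) n (leq_maxl _ _) Nn => h1.
  have h2 := ray_gp rc (leq_maxr N (nm h)).
  have h3 : (nm h)%:R - delta <= gp (c (nm h)) (s n).
    by case: (gp_hyp hyp 1%g (c (nm h)) (c (maxn N (nm h))) (s n)); lra.
  have h4 := gp_lipl hyp 1%g (c (nm h)) (s n) h.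
  have e1 : dS (h * f)%g h = (nm f)%:R.
    by rewrite (distC hyp) word_distE mulKg.
  have := dist_tri hyp (h * f)%g h (s n); have := dist_tri hyp h (h * f)%g (s n).
  rewrite (distC hyp h (h * f)%g) e1; have := dist_tri hyp 1%g h (s n).
  move: h3 h4; rewrite /gromov_product !word_dist1.
  have d0 := delta_ge0 hyp; have n0 : 0 <= (nm f)%:R :> R by [].
  by move=> *; apply/andP; split; lra.
have hi : (busemann (h * f)%g xi <=
    (- (nm h)%:R + (2 * r + 4 * delta + (nm f)%:R))%:E)%E.
  apply: ge_ereal_sup => _ [s xs <-]; have [N hN] := bounds s xs.
  apply: (limf_esup_le (V := [set n | (N <= n)%N])); first by exists N.
  by move=> n Nn; rewrite lee_fin; case/andP: (hN n Nn).
have lo : ((- (nm h)%:R - (nm f)%:R)%:E <= busemann (h * f)%g xi)%E.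
  apply: le_trans (ereal_sup_ubound _); last by exists c.
  have [N hN] := bounds c xc.
  apply: (limf_esup_ge (V := [set n | (N <= n)%N])); first by exists N.
  by move=> n Nn; rewrite lee_fin; case/andP: (hN n Nn).
by move: hi lo; case: (busemann _ _) => [b| |] //=; rewrite !lee_fin => -> ->.
Qed.

End Boundary.
(** * Probabilities as real numbers *)

Section RealProbability.
Context d (T : measurableType d) (R : realType) (P : probability T R).
Implicit Types (A B : set T).

Definition pr A : R := fine (P A).

Lemma prE A : measurable A -> P A = (pr A)%:E.
Proof. by move=> mA; rewrite /pr fineK// fin_num_measure. Qed.

Lemma pr_ge0 A : 0 <= pr A.
Proof. exact/fine_ge0/measure_ge0. Qed.

Lemma pr_le1 A : measurable A -> pr A <= 1.
Proof. by move=> mA; rewrite -lee_fin -prE// probability_le1. Qed.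

Lemma pr_setT : pr setT = 1.
Proof. by rewrite /pr probability_setT. Qed.

Lemma pr_le A B : measurable A -> measurable B -> A `<=` B -> pr A <= pr B.
Proof. by move=> mA mB AB; rewrite -lee_fin -!prE// le_measure ?inE. Qed.

Lemma prU A B : measurable A -> measurable B -> pr (A `|` B) <= pr A + pr B.
Proof.
move=> mA mB; rewrite -lee_fin EFinD -!prE//; last exact: measurableU.
exact: measureU2.
Qed.

Lemma prD A B : measurable A -> measurable B -> A `<=` B ->
  pr (B `\` A) = pr B - pr A.
Proof.
move=> mA mB AB; apply: EFin_inj; rewrite EFinB -!prE//; last exact: measurableD.
rewrite measureD//; last by rewrite ltey_eq fin_num_measure.
by rewrite setIidr.
Qed.

Lemma pr_sum_ge (I : eqType) (L : seq I) (A : I -> set T) B :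
  measurable B -> (forall i, measurable (A i)) ->
  (forall x, B x -> exists2 i, i \in L & A i x) -> pr B <= \sum_(i <- L) pr (A i).
Proof.
move=> + mA; elim: L B => [|i L ih] B mB cov.
  rewrite big_nil; suff -> : B = set0 by rewrite /pr measure0.
  by rewrite -subset0 => x /cov[].
rewrite big_cons.
have mD : measurable (B `\` A i) by exact: measurableD.
have sub : B `<=` A i `|` (B `\` A i).
  by move=> x Bx; have [Ax|nAx] := pselect (A i x); [left|right].
apply: le_trans (pr_le mB (measurableU _ _ (mA i) mD) sub) _.
apply: le_trans (prU (mA i) mD) _.
rewrite lerD2l; apply: ih => // x [/cov[j]]; rewrite inE => /orP[/eqP->//|jL] Ajx _.
by exists j.
Qed.

Lemma pr_sum_le (I : eqType) (L : seq I) (r : rel I) (A : I -> set T) B :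
  measurable B -> (forall i, measurable (A i)) -> pairwise r L ->
  (forall i j, r i j -> A i `&` A j = set0) ->
  (forall i, i \in L -> A i `<=` B) -> \sum_(i <- L) pr (A i) <= pr B.
Proof.
move=> + mA + disj; elim: L B => [|i L ih] B mB; first by rewrite big_nil pr_ge0.
rewrite pairwise_cons big_cons => /andP[/allP iL pL] sub.
have Ai : A i `<=` B by apply: sub; rewrite mem_head.
have := ih (B `\` A i) (measurableD mB (mA i)) pL.
rewrite prD//; suff h : forall j, j \in L -> A j `<=` B `\` A i by move=> /(_ h); lra.
move=> j jL x Ajx; split; first by apply: sub Ajx; rewrite inE jL orbT.
by move=> Aix; have := disj _ _ (iL _ jL); rewrite -subset0; apply; split; [exact: Aix|].
Qed.

(** The unions of the tails of [A] decrease to the empty set, so their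
    probabilities tend to 0. *)
Lemma pr_eq0_limsup (A : (set T)^nat) B (c : R) (N : nat) : measurable B ->
  (forall n, measurable (A n)) ->
  (forall x, exists n0, forall n, (n0 <= n)%N -> ~ A n x) ->
  (forall n, (N <= n)%N -> pr B <= c * pr (A n)) -> pr B = 0.
Proof.
move=> mB mA fin bd; pose Z n := \bigcup_(m in [set m | (n <= m)%N]) A m.
have mZ n : measurable (Z n) by apply: bigcup_measurable => m _; exact: mA.
have Z0 : \bigcap_n Z n = set0.
  rewrite -subset0 => x Zx; have [n0 hn0] := fin x.
  by have [m /= nm Amx] := Zx n0 I; exact: hn0 nm Amx.
have cvZ : P \o Z @ \oo --> 0%E.
  rewrite -(measure0 P) -Z0; apply: nonincreasing_cvg_mu => //.
  - by rewrite ltey_eq fin_num_measure.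
  - by rewrite Z0.
  - move=> n m nm; apply/subsetPset => x [k /= mk Akx]; exists k => //=.
    exact: leq_trans nm mk.
have cvr : pr (Z n) @[n --> \oo] --> (0 : R).
  apply: (@fine_cvg _ _ _ _ (fun n => P (Z n)) (0 : R)); exact: cvZ.
apply/eqP; rewrite eq_le pr_ge0 andbT leNgt; apply/negP => B0.
have AZ n : pr (A n) <= pr (Z n) by apply: pr_le => // x Ax; exists n => /=.
have c0 : 0 < c.
  rewrite ltNge; apply/negP => c0.
  by have := bd N (leqnn _); have := mulr_le0_ge0 c0 (pr_ge0 (A N)); lra.
have /cvgr0Pnorm_lt/(_ (pr B / c))[|M _ hM] := cvr; first by rewrite divr_gt0.
have := hM (maxn N M) (leq_maxr _ _); rewrite /= ger0_norm ?pr_ge0// ltr_pdivlMr//.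
have := bd (maxn N M) (leq_maxl _ _); have := AZ (maxn N M).
by rewrite -(ler_pM2l c0); lra.
Qed.

End RealProbability.

Lemma ae_imp d (T : measurableType d) (R : realType)
    (mu : {measure set T -> \bar R}) (P Q : T -> Prop) :
  (forall x, P x -> Q x) -> {ae mu, forall x, P x} -> {ae mu, forall x, Q x}.
Proof. by move=> PQ; exact: filterS. Qed.

Lemma ae_forall_nat d (T : measurableType d) (R : realType)
    (mu : {measure set T -> \bar R}) (P : nat -> T -> Prop) :
  (forall n, {ae mu, forall x, P n x}) -> {ae mu, forall x, forall n, P n x}.
Proof. exact: ae_foralln. Qed.

Lemma integral_bounds d (T : measurableType d) (R : realType)
    (mu : probability T R) (A : set T) (f : T -> \bar R) (a b : R) :
  measurable A -> measurable_fun A f -> 0 <= a <= b ->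
  {ae mu, forall x, A x -> (a%:E <= f x <= b%:E)%E} ->
  ((a * pr mu A)%:E <= \int[mu]_(x in A) f x <= (b * pr mu A)%:E)%E.
Proof.
move=> mA mf /andP[a0 ab] hf.
have f_ge0 : ae_eq mu A f (f^\+)%E.
  apply: filterS hf => x + Ax => /(_ Ax)/andP[ax _].
  by rewrite funeposE max_l//; apply: le_trans ax; rewrite lee_fin.
have mfp : measurable_fun A (f^\+)%E by exact: measurable_funepos.
rewrite (ae_eq_integral _ _ mA mf mfp f_ge0).
rewrite !EFinM -!(prE mu mA) -!(integral_cst mu mA); apply/andP; split; apply: ae_ge0_le_integral => //.
- apply: filterS2 f_ge0 hf => x fE + Ax => /(_ Ax)/andP[ax _].
  by rewrite -(fE Ax).
- by move=> x _; rewrite lee_fin (le_trans a0 ab).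
- apply: filterS2 f_ge0 hf => x fE + Ax => /(_ Ax)/andP[_ bx].
  by rewrite -(fE Ax).
Qed.

(** Greedy selection, as in Vitali's covering lemma. *)
Lemma separated_sublist (T : eqType) (r : rel T) (s : seq T) : reflexive r ->
  exists L, [/\ {subset L <= s}, pairwise (fun a b => ~~ r a b) L &
    forall h, h \in s -> exists2 h', h' \in L & r h h'].
Proof.
move=> rr; elim: s => [|h s [L [sub pL cov]]]; first by exists [::].
have [/hasP[h' h'L hh']|nh] := boolP (has (r h) L).
  exists L; split=> // [a /sub as_|a]; first by rewrite inE as_ orbT.
  by rewrite inE => /orP[/eqP ->|/cov//]; exists h'.
exists (h :: L); split=> [a|/=|a].
- by rewrite !inE => /orP[->//|/sub ->]; rewrite orbT.
- rewrite pL andbT; apply/allP => a aL; apply/negP => ra.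
  by move/hasP: nh; apply; exists a.
- rewrite inE => /orP[/eqP ->|/cov[h' h'L rh']].
    by exists h; rewrite ?mem_head.
  by exists h' => //; rewrite inE h'L orbT.
Qed.
(** * Shadows have comparable measure; almost every point is recurrent *)

Section PattersonSullivan.
Context {R : realType} {G : groupType} {S : set G}.
Hypotheses (finS : finite_set S) (genS : generates S) (ne : nonelementary G).
Local Notation dS := (word_dist S : G -> G -> R).
Local Notation nm := (word_norm S).
Local Notation gp := (gromov_product dS 1%g).
Local Notation bd := (boundary dS).
Implicit Types (f g h x y z : G) (xi eta zeta : bd) (r F : R).
Variable delta : R.
Hypothesis hyp : hyperbolic_at delta dS.
Variable nu : probability (borel_boundary dS) R.
Hypothesis nu_PS : patterson_sullivan nu.
Local Notation P := (pr nu).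

Let v : R := fine (growth_rate dS).

Lemma open_measurable_boundary (U : set bd) : open U ->
  measurable (U : set (borel_boundary dS)).
Proof. by move=> oU; apply: sub_sigma_algebra. Qed.

Definition open_shadow h r : set (borel_boundary dS) := (shadow h r : set bd)°.

Lemma open_shadow_open h r : open (open_shadow h r : set bd).
Proof. exact: open_interior. Qed.

Lemma open_shadow_measurable h r : measurable (open_shadow h r).
Proof. exact: open_measurable_boundary (@open_shadow_open h r). Qed.

Lemma open_shadow_sub h r : open_shadow h r `<=` shadow h r.
Proof. exact: interior_subset. Qed.

Lemma act_measurable h (U : set bd) : open U ->
  measurable (boundary_act h @^-1` U : set (borel_boundary dS)).
Proof.
move=> oU; have := boundary_act_open finS genS ne hyp (g := h) oU.
exact: open_measurable_boundary.
Qed.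

(** Quasi-conformality of the measure at the scale of shadows: a translation by
    [h] rescales subsets of the shadow of [h] by a constant factor, up to
    bounded distortion, and short factors [f] do not matter. *)
Lemma quasi_conformal r F : exists2 K : R, 0 < K & forall h f (A : set (borel_boundary dS)),
  (nm f)%:R <= F -> measurable A -> measurable (boundary_act (h * f)%g @^-1` A : set (borel_boundary dS)) ->
  A `<=` shadow h r ->
  K^-1 * expR (v * (nm h)%:R) * P A <= P (boundary_act (h * f)%g @^-1` A)
    <= K * expR (v * (nm h)%:R) * P A.
Proof.
have d0 := delta_ge0 hyp; have [C C1 hC] := nu_PS.
pose e0 := `|2 * r + 4 * delta| + F; pose K := C * expR (`|v| * e0).
have K0 : 0 < K by rewrite mulr_gt0 ?expR_gt0//; lra.
exists K => // h f A fF mA mA' Ash.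
have [mu [muE mu_nu hmu]] := hC (h * f)%g.
pose E := expR (v * (nm h)%:R); have E0 : 0 < E := expR_gt0 _.
have bounds : {ae nu, forall xi, A xi -> ((K^-1 * E)%:E <=
    Radon_Nikodym (charge_of_finite_measure mu) nu xi <= (K * E)%:E)%E}.
  apply: ae_imp hmu => xi /= /andP[lo hi] /Ash /(busemann_shadow finS genS ne hyp f).
  set b := fine (busemann _ _) in lo hi * => hb.
  have : `|- v * b - v * (nm h)%:R| <= `|v| * e0.
    rewrite (_ : _ - _ = - v * (b + (nm h)%:R)); last by lra.
    rewrite normrM normrN ler_wpM2l// ler_norml /e0.
    have := ler_norm (2 * r + 4 * delta); have : 0 <= (nm f)%:R :> R by [].
    have := normr_ge0 (2 * r + 4 * delta).
    by move: hb => /andP[h1 h2] *; apply/andP; split; lra.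
  rewrite ler_norml => /andP[e1 e2].
  have ub : expR (- v * b) <= E * expR (`|v| * e0) by rewrite -expRD ler_expR; lra.
  have lb : E * (expR (`|v| * e0))^-1 <= expR (- v * b).
    by rewrite -expRN -expRD ler_expR; lra.
  apply/andP; split; [apply: le_trans lo|apply: le_trans hi _].
    rewrite lee_fin /K invfM -mulrA ler_pM2l ?invr_gt0; last lra.
    by rewrite mulrC; exact: lb.
  rewrite lee_fin /K -mulrA ler_pM2l; last lra.
  by rewrite [leRHS]mulrC; exact: ub.
have := integral_bounds mA _ _ bounds.
have -> : (\int[nu]_(x in A) Radon_Nikodym (charge_of_finite_measure mu) nu x)%E = mu A.
  by rewrite -Radon_Nikodym_integral.
rewrite muE// (prE nu mA') !lee_fin; apply.
- apply: measurable_funTS; apply: (measurable_int nu).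
  exact: Radon_Nikodym_integrable.
- have K1 : 1 <= K.
    rewrite /K; apply: le_trans (ltW C1) _; rewrite ler_peMr//; first lra.
    by rewrite -expR0 ler_expR mulr_ge0// addr_ge0//; apply: le_trans fF.
  apply/andP; split; first by rewrite mulr_ge0 ?invr_ge0 ?ltW.
  by rewrite ler_pM2r//; apply: le_trans (K1); rewrite invf_le1.
Qed.

(** The lower half of the shadow lemma: between them, [h] and a neighbor [h * f] move
    every boundary point into the shadow of [h], so one of the two preimages of
    this shadow has measure at least one half. *)
Lemma shadow_measure_ge : exists r K : R, [/\ 0 <= r, 0 < K & forall h,
  expR (- v * (nm h)%:R) <= K * P (open_shadow h r)].
Proof.
have d0 := delta_ge0 hyp.
have [C C0 hC] := shadow_covers_twice finS genS ne hyp.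
pose r := C + 4 * delta; have [K K0 hK] := quasi_conformal r C.
exists r, (2 * K); split; [by rewrite /r; lra|by lra|] => h.
have [f fC hf] := hC h; set A := open_shadow h r.
have mA : measurable A := open_shadow_measurable h r.
have m1 : measurable (boundary_act h @^-1` A : set (borel_boundary dS)).
  by apply: act_measurable; exact: open_shadow_open.
have m2 : measurable (boundary_act (h * f)%g @^-1` A : set (borel_boundary dS)).
  by apply: act_measurable; exact: open_shadow_open.
have cov : [set: borel_boundary dS] `<=` (boundary_act h @^-1` A) `|` (boundary_act (h * f)%g @^-1` A).
  move=> xi _; have [hxi|hxi] := hf xi; [left|right];
    exact: (shadow_interior finS genS ne hyp).
have := pr_le nu measurableT (measurableU _ _ m1 m2) cov.
rewrite pr_setT => /le_trans/(_ (prU nu m1 m2)) one.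
have /andP[_ h2] := hK h f A fC mA m2 (@open_shadow_sub h r).
have := hK h 1%g A; rewrite mulg1 word_norm1// => /(_ C0 mA m1 (@open_shadow_sub h r)).
move=> /andP[_ h1]; rewrite mulNr expRN -(ler_pM2l (expR_gt0 (v * (nm h)%:R))).
by rewrite mulfV ?gt_eqF ?expR_gt0//; lra.
Qed.

(** The upper half of the shadow lemma: the translate of a shadow by [h^-1] has
    measure at most 1. *)
Lemma shadow_measure_le r : exists2 K : R, 0 < K & forall h,
  P (open_shadow h r) <= K * expR (- v * (nm h)%:R).
Proof.
have [K K0 hK] := quasi_conformal r 0; exists K => // h; set A := open_shadow h r.
have mA : measurable A := open_shadow_measurable h r.
have m1 : measurable (boundary_act h @^-1` A : set (borel_boundary dS)).
  by apply: act_measurable; exact: open_shadow_open.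
have := hK h 1%g A; rewrite mulg1 word_norm1// => /(_ (lexx _) mA m1 (@open_shadow_sub h r)).
move=> /andP[/le_trans/(_ (pr_le1 nu m1)) + _].
rewrite -mulrA ler_pdivrMl// mulr1 => h1.
rewrite mulNr expRN -(ler_pM2l (expR_gt0 (v * (nm h)%:R))) mulrCA.
by rewrite mulfV ?gt_eqF ?expR_gt0// mulr1.
Qed.

(** Let [B] be the closed set of the points that lie in no open shadow of a good pair
    for [x] that starts beyond [N].  For every [n >= N] it is covered by the shadows
    of the elements of norm [n] whose shadows meet [B], and each of these shadows
    contains, up to enlarging it, a definite proportion of points outside [B],
    because a good pair starts right there.  So the union [Wn n] of these parts has
    measure at least a constant times the measure of [B].  But a point of [Wn n] has
    a point of [B] at scale [n] around it, and as [B] is closed, a point outside [B]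
    is in finitely many [Wn n]. *)
Lemma recurrence : exists C r : R, [/\ 0 <= C, 0 <= r & forall x N,
  {ae nu, forall xi, exists g g', [/\ good_pair (S := S) C x g g', (N <= nm g)%N,
    (nm g < nm g')%N & shadow g' r xi]}].
Proof.
have d0 := delta_ge0 hyp; have [C C0 hC] := good_pairs finS genS ne hyp.
have [r [K1 [r0 K10 hK1]]] := shadow_measure_ge.
exists C, r; split=> // x N.
pose r3 := 2 * C + 2 * r + 2 * delta; pose t := 2 * r3 + 4 * delta.
have r30 : 0 <= r3 by rewrite /r3; lra.
have t0 : 0 <= t by rewrite /t; lra.
have [K2 K20 hK2] := shadow_measure_le (t + 4 * delta).
have /choice[p hp] h : exists p : G * G, [/\ good_pair (S := S) C x p.1 p.2,
    (nm h <= nm p.1)%N, (nm p.1 < nm p.2)%N, gp h^-1%g (h^-1 * p.2)%g <= C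
    & (nm (h^-1 * p.2)%g)%:R <= (nm x)%:R + C].
  by have [g [g' hg]] := hC h x; exists (g, g').
pose A h := open_shadow (p h).2 r.
pose D := [set q : G * G | [/\ good_pair (S := S) C x q.1 q.2, (N <= nm q.1)%N
  & (nm q.1 < nm q.2)%N]].
pose W : set bd := \bigcup_(q in D) open_shadow q.2 r.
have oW : open W by apply: bigcup_open => q _; exact: open_shadow_open.
pose B : set (borel_boundary dS) := ~` W.
have mW : measurable (W : set (borel_boundary dS)) := open_measurable_boundary oW.
have mB : measurable B := measurableC mW.
suff B0 : P B = 0.
  exists B; split=> //; first by rewrite prE// B0.
  move=> xi nxi Wxi; apply: nxi; have [[g g'] [h1 h2 h3] h4] := Wxi.
  by exists g, g'; split=> //; exact: open_shadow_sub h4.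
have A_sub h : A h `<=` shadow h r3.
  move=> xi /(@open_shadow_sub _ _); have [_ h1 h2 h3 _] := hp h.
  by apply: (shadow_sub hyp h3); lia.
have A_ge h : P (open_shadow h (t + 4 * delta)) <=
    K2 * expR (`|v| * ((nm x)%:R + C)) * K1 * P (A h).
  apply: le_trans (hK2 h) _; rewrite -2!mulrA ler_pM2l//.
  apply: le_trans (ler_wpM2l (expR_ge0 (`|v| * ((nm x)%:R + C))) (hK1 (p h).2)).
  rewrite -expRD ler_expR.
  have [_ _ _ _ h5] := hp h; set g' := (p h).2 in h5 *.
  have n1 : `|(nm g')%:R - (nm h)%:R| <= (nm x)%:R + C.
    have := dist_tri hyp 1%g h g'; have := dist_tri hyp 1%g g' h.
    rewrite (distC hyp g' h) !word_dist1 word_distE => h1 h2.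
    by rewrite ler_norml; apply/andP; split; lra.
  have := ler_norm (v * ((nm g')%:R - (nm h)%:R)); rewrite normrM.
  have := ler_wpM2l (normr_ge0 v) n1; lra.
pose H n := fset_set [set h | nm h = n /\ exists2 xi, B xi & shadow h 0 xi].
have HE n h : h \in H n <-> nm h = n /\ exists2 xi, B xi & shadow h 0 xi.
  rewrite in_fset_set; first by rewrite inE.
  by apply: sub_finite_set (word_norm_finite genS n finS) => a [/= -> _].
pose Wn n : set (borel_boundary dS) := \bigcup_(h in [set h | h \in H n]) A h.
have mA h : measurable (A h) by exact: open_shadow_measurable.
have mWn n : measurable (Wn n).
  by apply: open_measurable_boundary; apply: bigcup_open => h _; exact: open_shadow_open.
apply: (pr_eq0_limsup (A := Wn) (c := K2 * expR (`|v| * ((nm x)%:R + C)) * K1) (N := N)) => //.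
  move=> xi; have [Wxi|nWxi] := pselect (W xi); last first.
    exists N => n Nn [h /HE[hn _] Ahxi]; apply: nWxi; exists (p h) => //.
    by have [h1 h2 h3 _ _] := hp h; split=> //; lia.
  have [q hq] : exists q : R, forall eta, (q%:E < boundary_product xi eta)%E -> W eta.
    exact: oW.
  exists (Num.truncn (q + r3 + 2 * delta)).+1 => n hn [h /HE[nh [eta Beta heta]] Ahxi].
  apply: Beta; apply: hq.
  have heta' : shadow h r3 eta by apply: shadow_le heta.
  apply: lt_le_trans (shadow_product hyp (A_sub h xi Ahxi) heta').
  have := truncnS_gt (q + r3 + 2 * delta); rewrite lte_fin nh.
  have : (Num.truncn (q + r3 + 2 * delta)).+1%:R <= n%:R :> R by rewrite ler_nat.
  by lra.
move=> n Nn; pose cl : rel G := fun h h' => dS h h' <= t.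
have clr : reflexive cl by move=> h; rewrite /cl (dist_xx hyp).
have [L [LH pL covL]] := @separated_sublist _ cl (H n) clr.
have LHE h : h \in L -> nm h = n by move=> /LH/HE[].
apply: (@le_trans _ _ (\sum_(h <- L) P (open_shadow h (t + 4 * delta)))).
  apply: pr_sum_ge => // [h|xi Bxi]; first exact: open_shadow_measurable.
  have [h nh hxi] := shadow_cover finS genS ne hyp xi n.
  have [|h' h'L hh'] := covL h; first by apply/HE; split=> //; exists xi.
  exists h' => //; apply: (shadow_interior finS genS ne hyp).
  rewrite -(add0r t); apply: (shadow_move hyp _ hh') hxi.
  by rewrite nh LHE.
apply: (@le_trans _ _ (K2 * expR (`|v| * ((nm x)%:R + C)) * K1 * \sum_(h <- L) P (A h))).
  by rewrite mulr_sumr; apply: ler_sum => h _; exact: A_ge.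
rewrite ler_pM2l; last by rewrite !mulr_gt0// expR_gt0.
pose sep : rel G := fun h h' => (nm h == nm h') && ~~ cl h h'.
apply: (@pr_sum_le _ _ _ nu _ L sep) => //.
- have : all (fun h => nm h == n) L by apply/allP => h /LHE ->.
  elim: (L) pL => [//|h l ih] /= /andP[al pl] /andP[/eqP nh nl].
  rewrite ih// andbT; apply/allP => h' h'l; rewrite /sep nh eq_sym (allP nl)//=.
  exact: (allP al).
- move=> h h' /andP[/eqP nh /negP nc]; rewrite -subset0 => xi [/A_sub h1 /A_sub h2].
  by apply: nc; apply: (shadow_overlap finS genS ne hyp nh h1 h2).
- by move=> h /LH hH xi Axi; exists h.
Qed.

End PattersonSullivan.
(** * Translation lengths *)

Section TranslationLength.
Context {R : realType} {G : groupType}.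
Implicit Types (d : G -> G -> R) (g h x y : G).

(** Fekete's lemma.  It matters because [trans_length] is defined as a [lim], which
    has no meaning before the limit is known to exist. *)
Lemma fekete (a : nat -> R) : (forall n, 0 <= a n) ->
  (forall m n, a (m + n)%N <= a m + a n) -> cvgn (fun n => a n / n%:R).
Proof.
move=> a0 sub; pose A := [set a n / n%:R | n in [set n | (0 < n)%N]].
have hA : has_inf A.
  split; first by exists (a 1%N / 1%:R), 1%N.
  by exists 0 => _ [n _ <-]; rewrite divr_ge0.
have mulsub m q : a (q * m)%N <= q%:R * a m + a 0%N.
  elim: q => [|q ih]; first by rewrite mul0n mul0r add0r.
  by rewrite mulSn -natr1; have := sub m (q * m)%N; lra.
apply/cvg_ex; exists (inf A); apply/cvgrPdist_le => e e0.
have e20 : 0 < e / 2 by rewrite divr_gt0.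
have [_ [m m0 <-] hm] := inf_adherent e20 hA.
have [M M0 hM] := @initial_bound R a m.
have [k hk] : exists k : nat, 2 * (M + a 0%N) / e <= k%:R.
  by exists (Num.truncn (2 * (M + a 0%N) / e)).+1; apply/ltW/truncnS_gt.
near=> n; have n0 : (0 < n)%N by near: n; exact: nbhs_infty_gt.
have kn : (k <= n)%N by near: n; exact: nbhs_infty_ge.
have mR : 0 < m%:R :> R by rewrite ltr0n.
have nR : 0 < n%:R :> R by rewrite ltr0n.
have lo : inf A <= a n / n%:R by apply: ge_inf; [exact: hA.2|exists n].
rewrite ler0_norm ?subr_le0// opprB lerBlDr.
have := hM (n %% m)%N (ltn_pmod n m0); have := mulsub m (n %/ m)%N.
have := sub (n %/ m * m)%N (n %% m)%N; rewrite -divn_eq => h1 h2 h3.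
have h4 : (n %/ m)%:R * a m <= n%:R * (a m / m%:R).
  rewrite mulrCA mulrC ler_wpM2l// ler_pdivlMr// -natrM ler_nat.
  exact: leq_trunc_div.
have h5 : M + a 0%N <= n%:R * (e / 2).
  have : 2 * (M + a 0%N) / e <= n%:R by apply: le_trans hk _; rewrite ler_nat.
  by rewrite ler_pdivrMr//; lra.
rewrite ler_pdivrMr//; have : (a m / m%:R) * n%:R <= (inf A + e / 2) * n%:R.
  by rewrite ler_pM2r// ltW.
by lra.
Unshelve. all: by end_near. Qed.

Section Metric.
Variable d : G -> G -> R.
Hypotheses (pm : pseudo_metric d) (li : left_invariant d).

Lemma dist_expg_sub x m n :
  d 1%g (x ^+ (m + n))%g <= d 1%g (x ^+ m)%g + d 1%g (x ^+ n)%g.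
Proof.
have [_ _ _ dtri] := pm; rewrite -(li (x ^+ m)%g 1%g (x ^+ n)%g) mulg1 -expgnDr.
exact: dtri.
Qed.

Lemma trans_length_cvg x :
  (d 1%g (x ^+ n)%g / n%:R) @[n --> \oo] --> trans_length d x.
Proof.
have [_ dge _ _] := pm; apply: fekete => [n|m n]; first exact: dge.
exact: dist_expg_sub.
Qed.

Lemma trans_length_le x : trans_length d x <= d 1%g x.
Proof.
have [dxx dge _ _] := pm.
apply: (limr_le (f := fun n => d 1%g (x ^+ n)%g / n%:R)).
  by apply/cvg_ex; exists (trans_length d x); exact: trans_length_cvg.
near=> n; have n0 : (0 < n)%N by near: n; exact: nbhs_infty_gt.
rewrite ler_pdivrMr ?ltr0n// mulrC; elim: (n) => [|k ih].
  by rewrite expg0 dxx mul0r.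
by have := dist_expg_sub x k 1; rewrite addn1 expg1 -natr1; lra.
Unshelve. all: by end_near. Qed.

Lemma trans_length_ge x (c : R) : (forall n, n%:R * c <= d 1%g (x ^+ n)%g) ->
  c <= trans_length d x.
Proof.
move=> hc; apply: (limr_ge (f := fun n => d 1%g (x ^+ n)%g / n%:R)).
  by apply/cvg_ex; exists (trans_length d x); exact: trans_length_cvg.
near=> n; have n0 : (0 < n)%N by near: n; exact: nbhs_infty_gt.
by rewrite ler_pdivlMr ?ltr0n// mulrC.
Unshelve. all: by end_near. Qed.

Lemma trans_length_conj x g : trans_length d (x ^ g)%g = trans_length d x.
Proof.
have [_ dge dC dtri] := pm; pose c := d 1%g g.
have close n : `|d 1%g (x ^+ n)%g - d 1%g ((x ^ g) ^+ n)%g| <= 2 * c.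
  have e1 : d g (x ^+ n * g)%g = d 1%g ((x ^ g) ^+ n)%g.
    by rewrite -conjXg /conjg -(li g^-1%g g) mulVg.
  have e2 : d (x ^+ n)%g (x ^+ n * g)%g = c.
    by rewrite /c -(li (x ^+ n)%g 1%g g) mulg1.
  have := dtri 1%g g (x ^+ n)%g; have := dtri g (x ^+ n * g)%g (x ^+ n)%g.
  have := dtri g 1%g (x ^+ n * g)%g; have := dtri 1%g (x ^+ n)%g (x ^+ n * g)%g.
  rewrite (dC (x ^+ n * g)%g (x ^+ n)%g) (dC g 1%g) e1 e2 -/c ler_norml.
  by move=> *; apply/andP; split; lra.
have zero : (d 1%g (x ^+ n)%g / n%:R - d 1%g ((x ^ g) ^+ n)%g / n%:R) @[n --> \oo]
    --> (0 : R).
  apply/cvgr0Pnorm_le => e e0; near=> n.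
  have n0 : (0 < n)%N by near: n; exact: nbhs_infty_gt.
  have nk : ((Num.truncn (2 * c / e)).+1 <= n)%N by near: n; exact: nbhs_infty_ge.
  have nR : 0 < n%:R :> R by rewrite ltr0n.
  rewrite -mulrBl normrM normfV (ger0_norm (ltW nR)) ler_pdivrMr//.
  apply: le_trans (close n) _; rewrite -ler_pdivrMl//.
  rewrite mulrC; apply: le_trans (ltW (truncnS_gt _)) _.
  by rewrite ler_nat.
have diff : (d 1%g (x ^+ n)%g / n%:R - d 1%g ((x ^ g) ^+ n)%g / n%:R) @[n --> \oo]
    --> trans_length d x - trans_length d (x ^ g)%g.
  by apply: cvgB; exact: trans_length_cvg.
apply/eqP; rewrite eq_sym -subr_eq0; apply/eqP.
by rewrite -(cvg_lim (@Rhausdorff R) diff) (cvg_lim (@Rhausdorff R) zero).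
Unshelve. all: by end_near. Qed.

End Metric.

End TranslationLength.
(** * Rigidity from good pairs *)

Section Rigidity.
Context {R : realType} {G : groupType} {S : set G}.
Hypotheses (finS : finite_set S) (genS : generates S).
Local Notation dS := (word_dist S : G -> G -> R).
Local Notation nm := (word_norm S).
Local Notation gp := (gromov_product dS 1%g).
Implicit Types (d : G -> G -> R) (f g h x y z : G) (C K : R).
Variable delta : R.
Hypothesis hyp : hyperbolic_at delta dS.

(** A long element that is cyclically reduced stays so under iteration, because
    [g^-1 * g ^- n] keeps the initial direction of [g^-1]; a short one has small
    products anyway. *)
Lemma gp_powers C g n : gp g g^-1%g <= C -> gp (g ^- n)%g g <= 2 * C + 2 * delta.
Proof.
move=> gC; have d0 := delta_ge0 hyp; have g0 := gp_ge0 hyp 1%g g g^-1%g.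
have [short|long] := leP (nm g)%:R (2 * C + 2 * delta).
  by apply: le_trans short; rewrite -word_dist1; exact: gp_ler hyp _ _ _.
suff : gp (g ^- n)%g g <= C + delta by lra.
elim: n => [|n ih]; first by rewrite expg0 invg1 (gp_wx hyp); lra.
have := gp_mul_left hyp g^-1%g (g ^- n)%g; rewrite (word_normV genS) invgK.
have -> : (g^-1 * g ^- n = g ^- n.+1)%g by rewrite expgSr invgM.
rewrite (gpC hyp _ g (g ^- n)%g) (gpC hyp _ _ g^-1%g) => e1.
by have := gp_hyp hyp 1%g g^-1%g (g ^- n.+1)%g g; rewrite (gpC hyp _ g^-1%g g) => -[]; lra.
Qed.

Section Metric.
Variables (d : G -> G -> R) (K : R).
Hypotheses (pm : pseudo_metric d) (li : left_invariant d) (K0 : 0 <= K).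
Hypothesis dK : forall x y, gromov_product d 1%g x y <= K * gp x y + K.

(** Each further factor [g] adds the norm of [g] up to a bounded cancellation. *)
Lemma trans_length_reduced C g : gp g g^-1%g <= C ->
  d 1%g g - 2 * (K * (2 * C + 2 * delta) + K) <= trans_length d g.
Proof.
move=> gC; apply: trans_length_ge => // n.
have [dxx dge dC dtri] := pm; have kk := K0.
elim: n => [|n ih]; first by rewrite mul0r.
have e1 : d (g ^- n)%g g = d 1%g (g ^+ n.+1)%g.
  by rewrite -(li (g ^+ n)%g) mulgV -expgSr.
have e2 : d 1%g (g ^- n)%g = d 1%g (g ^+ n)%g.
  by rewrite -(li (g ^+ n)%g) mulgV mulg1 dC.
have h1 : K * gp (g ^- n)%g g <= K * (2 * C + 2 * delta).
  by rewrite ler_wpM2l// gp_powers.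
have := dK (g ^- n)%g g; rewrite {1}/gromov_product e1 e2 -(natr1 n); lra.
Qed.

Lemma dist_ball_bounded C : exists M : R, forall b, (nm b)%:R <= C -> d 1%g b <= M.
Proof.
have [_ dge _ _] := pm.
have fin : finite_set [set b | (nm b)%:R <= C].
  apply: sub_finite_set (word_norm_finite genS (Num.truncn C).+1 finS) => b /= bC.
  by rewrite -(ler_nat R); apply: le_trans bC (ltW (truncnS_gt C)).
exists (\sum_(b <- fset_set [set b | (nm b)%:R <= C]) d 1%g b) => b bC.
rewrite (big_fsetD1 b) /=; last by rewrite in_fset_set// inE.
by rewrite lerDl sumr_ge0.
Qed.

Lemma good_pair_length C : exists M : R, forall x g g', good_pair (S := S) C x g g' ->
  `|d 1%g x - (trans_length d g' - trans_length d g)| <= M.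
Proof.
have kk := K0; have [M hM] := dist_ball_bounded C.
have [dxx dge dC dtri] := pm.
exists (M + 2 * (K * C + K) + 2 * (K * (2 * C + 2 * delta) + K)).
move=> x g g' [b [g'E bC gb gg gg']].
have h1 := trans_length_reduced gg; have h2 := trans_length_reduced gg'.
have h3 := trans_length_le pm li g; have h4 := trans_length_le pm li g'.
have h5 : K * gp g^-1%g (x * b)%g <= K * C by rewrite ler_wpM2l.
have h6 := dK g^-1%g (x * b)%g.
have e1 : d 1%g g^-1%g = d 1%g g by rewrite -(li g) mulgV mulg1 dC.
have e2 : d g^-1%g (x * b)%g = d 1%g g' by rewrite -(li g) mulgV g'E.
have e3 : d x (x * b)%g = d 1%g b by rewrite -{1}(mulg1 x) li.
have := hM b bC; have := dtri 1%g x (x * b)%g; have := dtri 1%g (x * b)%g x.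
have := dtri g^-1%g 1%g (x * b)%g.
rewrite (dC (x * b)%g x) (dC g^-1%g 1%g) e1 e2 e3.
rewrite {1}/gromov_product e1 e2 in h6.
by move=> *; rewrite ler_norml; apply/andP; split; lra.
Qed.

End Metric.

(** Equal translation lengths on good pairs give equal norms up to a constant, so the
    rough similarity has ratio 1. *)
Lemma rigid_of_good_pairs C (E : set (set G)) :
  (forall x, exists g g', [/\ good_pair (S := S) C x g g', E (conj_class g) &
    E (conj_class g')]) -> spectrally_rigid R E.
Proof.
move=> hE d d' hd hd' eqE.
have [K K0 hK] := in_Dbar_product finS genS hd.
have [K' K'0 hK'] := in_Dbar_product finS genS hd'.
have [pm li _ _] := hd; have [pm' li' _ _] := hd'.
have [M hM] := good_pair_length pm li K0 hK C.
have [M' hM'] := good_pair_length pm' li' K'0 hK' C.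
exists 1, (`|M| + `|M'| + 1); split=> // x.
have [g [g' [gg' Eg Eg']]] := hE x.
have := hM x g g' gg'; have := hM' x g g' gg'.
rewrite (eqE g Eg) (eqE g' Eg') mul1r !ler_norml ltr_norml.
have := ler_norm M; have := ler_norm M'.
by move=> h1 h2 /andP[h3 h4] /andP[h5 h6]; apply/andP; split; lra.
Qed.

End Rigidity.

(** * Choosing sparse good pairs along a ray *)

Lemma enumerate_group (G : groupType) (S : set G) : finite_set S -> generates S ->
  exists e : nat -> G, forall x N, exists2 j, (N <= j)%N & e j = x.
Proof.
move=> finS genS.
pose ball k := [set g | (word_norm S g <= k)%N].
pose e0 n := let p := odflt (0%N, 0%N) (choice.unpickle n) in
  nth 1%g (fset_set (ball p.1)) p.2.
have e0s x : exists n, e0 n = x.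
  have xb : x \in fset_set (ball (word_norm S x)).
    rewrite in_fset_set; last exact: (word_norm_finite genS _ finS).
    by rewrite inE /ball /=.
  exists (choice.pickle (word_norm S x, index x (fset_set (ball (word_norm S x))))).
  by rewrite /e0 choice.pickleK /= nth_index.
(* every [i] is the 2-adic valuation of arbitrarily large numbers *)
exists (fun n => e0 (logn 2 n)) => x N; have [i <-] := e0s x.
exists (2 ^ i * N.*2.+1)%N.
  have : (0 < 2 ^ i)%N by rewrite expn_gt0.
  by nia.
rewrite lognM ?expn_gt0// pfactorK// [logn 2 N.*2.+1]lognE /= dvdn2 /= odd_double /=.
by rewrite addn0.
Qed.

(** The pairs are chosen one after the other and occupy the positions [2 j] and
    [2 j + 1] of the sequence. *)
Lemma sparse_pairs (T X : Type) (e : nat -> X) (Q : X -> T -> T -> Prop)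
    (size : T -> nat) (Th : nat -> nat) :
  (forall x N, exists2 j, (N <= j)%N & e j = x) ->
  (forall x N, exists a a', [/\ Q x a a', (N <= size a)%N & (size a < size a')%N]) ->
  exists h : nat -> T, [/\ forall i, (size (h i) < size (h i.+1))%N,
    forall i, (Th i <= size (h i))%N,
    forall i, exists x a, Q x (h i) a \/ Q x a (h i) &
    forall x N, exists2 i, (N <= i)%N & Q x (h i) (h i.+1)].
Proof.
move=> he hQ.
have /choice[F hF] (xN : X * nat) : exists p : T * T,
    [/\ Q xN.1 p.1 p.2, (xN.2 <= size p.1)%N & (size p.1 < size p.2)%N].
  by have [a [a' ?]] := hQ xN.1 xN.2; exists (a, a').
pose bound j N := maxn N (maxn (Th j.*2) (Th j.*2.+1)).
pose step j (p : T * T) := F (e j.+1, bound j.+1 (size p.2).+1).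
pose p := nat_rect (fun=> T * T)%type (F (e 0%N, bound 0%N 0%N)) step.
have p0 : p 0%N = F (e 0%N, bound 0%N 0%N) by [].
have pS j : p j.+1 = F (e j.+1, bound j.+1 (size (p j).2).+1) by [].
have hp j : [/\ Q (e j) (p j).1 (p j).2, (Th j.*2 <= size (p j).1)%N,
    (Th j.*2.+1 <= size (p j).1)%N & (size (p j).1 < size (p j).2)%N].
  case: j => [|j].
    have [h1 h2 h3] := hF (e 0%N, bound 0%N 0%N); rewrite -p0 in h1 h2 h3.
    by rewrite /bound in h2; split=> //=; move: h2 => /=; lia.
  have [h1 h2 h3] := hF (e j.+1, bound j.+1 (size (p j).2).+1).
  by rewrite -pS /bound in h1 h2 h3; split => //; move: h2 => /=; lia.
have pp j : (size (p j).2 < size (p j.+1).1)%N.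
  have [_ h2 _] := hF (e j.+1, bound j.+1 (size (p j).2).+1).
  by rewrite -pS /bound in h2; move: h2 => /=; lia.
pose h i := if odd i then (p i./2).2 else (p i./2).1.
have h_even j : h j.*2 = (p j).1 by rewrite /h odd_double doubleK.
have h_odd j : h j.*2.+1 = (p j).2 by rewrite /h /= odd_double /= uphalf_double.
have evenodd i : exists j, i = j.*2 \/ i = j.*2.+1.
  exists i./2; have := odd_double_half i; case: (odd i) => /= hi; [right|left];
    by rewrite -{1}hi.
exists h; split=> [i|i|i|x N].
- have [j [->|->]] := evenodd i; first by rewrite h_even h_odd; have [] := hp j.
  by rewrite h_odd -doubleS h_even.
- have [j [->|->]] := evenodd i; first by rewrite h_even; have [] := hp j.
  by rewrite h_odd; have [_ _ h1 h2] := hp j; lia.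
- have [j [->|->]] := evenodd i; exists (e j).
    by exists (p j).2; left; rewrite h_even; have [] := hp j.
  by exists (p j).1; right; rewrite h_odd; have [] := hp j.
- have [j Nj <-] := he x N; exists j.*2; first by lia.
  by rewrite h_even h_odd; have [] := hp j.
Qed.
(** * Recurrent rays and the theorem *)

Section RecurrentRay.
Context {R : realType} {G : groupType} {S : set G}.
Hypotheses (finS : finite_set S) (genS : generates S) (ne : nonelementary G).
Local Notation dS := (word_dist S : G -> G -> R).
Local Notation nm := (word_norm S).
Local Notation gp := (gromov_product dS 1%g).
Implicit Types (f g h x y z : G) (r : R).
Variable delta : R.
Hypothesis hyp : hyperbolic_at delta dS.
Variable C : R.

(** Good pairs whose shadows contain [xi] lie close to a geodesic ray to [xi], so
    they can be put on the ray itself at bounded cost. *)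
Lemma ray_through_good_pairs r (xi : boundary dS) : 0 <= C -> 0 <= r ->
  (forall x N, exists g g', [/\ good_pair (S := S) C x g g', (N <= nm g)%N,
    (nm g < nm g')%N & shadow g' r xi]) ->
  exists ray : nat -> G,
    [/\ rough_geodesic_ray dS (2 * (2 * C + 2 * r + 6 * delta) + 1) ray,
      ray 0%N = 1%g, converging_to xi ray &
      forall x N, exists k k', [/\ good_pair (S := S) C x (ray k) (ray k'),
        (N <= k)%N & (k < k')%N]].
Proof.
move=> C0 r0 hrec; have d0 := delta_ge0 hyp.
have [c rc xc] := converging_ray finS genS ne hyp xi.
have [e he] := enumerate_group finS genS.
pose Q x g g' := good_pair (S := S) C x g g' /\ (nm g <= nm g')%N /\ shadow g' r xi.
have [|h [h_inc _ h_shadow h_pair]] := @sparse_pairs G G e Q nm (fun=> 0%N) he.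
  by move=> x N; have [g [g' [h1 h2 h3 h4]]] := hrec x N; exists g, g'; split=> //;
    split=> //; split=> //; exact: ltnW.
have h_mono : {homo (fun i => nm (h i)) : i j / (i < j)%N}.
  by apply: homo_ltn => //; exact: ltn_trans.
have h_near i : dS (h i) (c (nm (h i))) <= 2 * C + 2 * r + 6 * delta.
  rewrite (distC hyp); have [x [g [[[b [gE _ gb _ _]] [le sh]]|[_ [_ sh]]]]] := h_shadow i.
    have sh' : shadow (h i) (2 * C + 2 * r + 2 * delta) xi.
      by apply: (shadow_sub hyp _ le) sh; rewrite gE mulKg.
    by have := shadow_ray finS genS ne hyp sh' rc xc; lra.
  by have := shadow_ray finS genS ne hyp sh rc xc; lra.
pose ray k := xget (c k) [set y | exists2 i, h i = y & nm y = k].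
have ray_near k : nm (ray k) = k /\ dS (ray k) (c k) <= 2 * C + 2 * r + 6 * delta.
  rewrite /ray; case: xgetP => [y _ [i <- <-]|_]; first by split.
  by rewrite (ray_norm _ rc) (dist_xx hyp); split=> //; lra.
have ray_h i : ray (nm (h i)) = h i.
  rewrite /ray; case: xgetP => [y _ [j <- hji]|/(_ (h i)) nh]; last first.
    by exfalso; apply: nh; exists i.
  case: (ltngtP j i) hji => [/h_mono|/h_mono|->//]; rewrite /= => lt eq;
    by rewrite eq ltnn in lt.
exists ray; split.
- move=> m n; have [_ hm] := ray_near m; have [_ hn] := ray_near n.
  have cmn : dS (c n) (c m) = `|m%:R - n%:R|.
    have [mn|mn] := leqP m n.
      by rewrite (distC hyp) (ray_dist rc)// distrC -natrB// ger0_norm.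
    by rewrite (ray_dist rc) 1?ltnW// -natrB 1?ltnW// ger0_norm.
  have := dist_tri hyp (ray n) (c n) (ray m); have := dist_tri hyp (c n) (c m) (ray m).
  have := dist_tri hyp (c n) (ray n) (c m); have := dist_tri hyp (ray n) (ray m) (c m).
  rewrite cmn (distC hyp (c n) (ray n)) (distC hyp (c m) (ray m)).
  by move=> *; apply/andP; split; lra.
- by have [/(word_norm_eq0 genS)] := ray_near 0%N.
- apply: (equiv_converging finS genS ne hyp xc).
  apply: (gromov_equiv_close hyp (B := 2 * C + 2 * r + 6 * delta)).
    exact: (ray_gromov hyp rc).
  by move=> n; rewrite (distC hyp); have [] := ray_near n.
- move=> x N; have [i Ni [hi _]] := h_pair x N.
  exists (nm (h i)), (nm (h i.+1)); rewrite !ray_h; split=> //.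
  apply: leq_trans Ni _; elim: (i) => // j ih.
  exact: leq_ltn_trans ih (h_inc j).
Qed.

Variable ray : nat -> G.
Hypothesis ray_pairs : forall x N, exists k k',
  [/\ good_pair (S := S) C x (ray k) (ray k'), (N <= k)%N & (k < k')%N].

Lemma tail_rigid N :
  spectrally_rigid R [set conj_class (ray k) | k in [set k | (N <= k)%N]].
Proof.
apply: (rigid_of_good_pairs finS genS hyp (C := C)) => x.
have [k [k' [gp_kk' Nk kk']]] := ray_pairs x N.
exists (ray k), (ray k'); split=> //; first by exists k.
by exists k' => //=; lia.
Qed.

(** Good pairs are cyclically reduced, so their translation lengths are close to
    their positions on the ray, and can be made to grow as fast as desired. *)
Lemma sparse_rigid (f : R -> R) (D : R) : (forall T, 0 < T -> 0 < f T) ->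
  f T @[T --> +oo] --> +oo -> rough_geodesic_ray dS D ray -> ray 0%N = 1%g ->
  exists n : nat -> nat,
    {homo n : i j / (i < j)%N} /\
    let E := range (fun k => conj_class (ray (n k))) in
    spectrally_rigid R E /\
    forall T : R, 0 < T ->
      let ET := [set conj_class x | x in
                  [set x | E (conj_class x) /\ trans_length dS x < T]] in
      finite_set ET /\ (#|` fset_set ET |)%:R <= f T.
Proof.
move=> f0 finfty rough ray0; pose C' := D + 2 * (1 * (2 * C + 2 * delta) + 1).
have pm := @word_dist_pseudo_metric R G S genS.
have li := @word_dist_left_invariant R G S.
have /choice[Th hTh] i : exists t : nat, forall T, t%:R - C' < T -> i.+1%:R <= f T.
  have /cvgryPge/(_ i.+1%:R)[M [_ hM]] := finfty.
  exists (Num.truncn (M + C')).+1 => T hT; apply: hM.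
  by have := truncnS_gt (M + C'); lra.
have [e he] := enumerate_group finS genS.
pose Q x k k' := good_pair (S := S) C x (ray k) (ray k').
have [|n [n_inc n_ge n_good n_pair]] := @sparse_pairs nat G e Q id Th he.
  by move=> x N; have [k [k' [h1 h2 h3]]] := ray_pairs x N; exists k, k'.
have len i : (n i)%:R - C' <= trans_length dS (ray (n i)).
  have red : gp (ray (n i)) (ray (n i))^-1%g <= C.
    by have [x [k [[b []]|[b []]]]] := n_good i.
  have := trans_length_reduced genS hyp (d := dS) (K := 1) pm li ler01 _ red.
  have := rough (n i) 0%N; rewrite ray0 subr0 ger0_norm// => /andP[h1 _] h2.
  have : (n i)%:R - D - 2 * (1 * (2 * C + 2 * delta) + 1) <= trans_length dS (ray (n i)).
    by apply: le_trans (h2 _) => [|x y]; [lra|lra].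
  by rewrite /C'; lra.
exists n; split; first by apply: homo_ltn => //; exact: ltn_trans.
move=> E; split.
  apply: (rigid_of_good_pairs finS genS hyp (C := C)) => x.
  have [i _ hi] := n_pair x 0%N; exists (ray (n i)), (ray (n i.+1)).
  by split=> //; [exists i|exists i.+1].
move=> T T0 ET; pose L := [seq conj_class (ray (n i)) | i <- iota 0 (Num.truncn (f T))].
have sub : ET `<=` [set` L].
  move=> _ [x [[i _ xE] xT] <-]; rewrite -xE /=; apply/mapP; exists i => //.
  rewrite mem_iota add0n truncn_gt_nat; apply: (hTh i).
  have : trans_length dS x = trans_length dS (ray (n i)).
    have : conj_class x x by exists 1%g; rewrite ?conjg1.
    by rewrite -xE => -[g _ <-]; exact: trans_length_conj.
  move=> xl; have := len i; have : (Th i)%:R <= (n i)%:R :> R by rewrite ler_nat.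
  by rewrite xl in xT; lra.
have finET : finite_set ET by apply: sub_finite_set sub _; exact: finite_seq.
split=> //; apply: (@le_trans _ _ (Num.truncn (f T))%:R); last first.
  by rewrite truncn_le ltW// f0.
rewrite ler_nat -[X in (_ <= X)%N](size_iota 0) -(size_map (fun i => conj_class (ray (n i)))).
apply: leq_trans (size_undup _); rewrite -card_fseq; apply: fsubset_leq_card.
apply/fsubsetP => A; rewrite in_fset_set// inE => /sub AL.
by rewrite !inE.
Qed.

End RecurrentRay.

Theorem theorem4p2 (R : realType) (Gamma : groupType)
    (Gamma_hyp : hyperbolic_group R Gamma) (Gamma_ne : nonelementary Gamma)
    (S : set Gamma) (finS : finite_set S) (genS : generates S)
    (nu : probability (borel_boundary (word_dist S : Gamma -> Gamma -> R)) R)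
    (nu_PS : patterson_sullivan nu) :
  exists2 D : R, 0 < D &
  {ae nu, forall xi, exists ray : nat -> Gamma,
    [/\ rough_geodesic_ray (word_dist S) D ray, ray 0%N = 1%g,
        converging_to xi ray,
        forall N : nat, (1 <= N)%N ->
          spectrally_rigid R [set conj_class (ray k) | k in [set k | (N <= k)%N]]
      & forall f : R -> R,
          (forall T : R, 0 < T -> 0 < f T) -> f T @[T --> +oo] --> +oo ->
          exists n : nat -> nat,
            {homo n : i j / (i < j)%N} /\
            let E := range (fun k => conj_class (ray (n k))) in
            spectrally_rigid R E /\
            forall T : R, 0 < T ->
              let ET := [set conj_class x | x in
                          [set x | E (conj_class x) /\
                                   trans_length (word_dist S) x < T]] in
              finite_set ET /\ (#|` fset_set ET |)%:R <= f T]}.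
Proof.
have [delta hyp] := word_hyperbolic finS genS Gamma_hyp.
have [C [r [C0 r0 rec]]] := recurrence finS genS Gamma_ne hyp nu_PS.
have d0 := delta_ge0 hyp; have [e he] := enumerate_group finS genS.
exists (2 * (2 * C + 2 * r + 6 * delta) + 1); first lra.
have rec_all := ae_forall_nat (fun n => rec (e n) n).
apply: ae_imp rec_all => xi rec_xi.
have [|ray [rough ray0 xi_ray pairs]] :=
    ray_through_good_pairs finS genS Gamma_ne hyp C0 r0 (xi := xi).
  move=> x N; have [n Nn <-] := he x N; have [g [g' [h1 h2 h3 h4]]] := rec_xi n.
  by exists g, g'; split=> //; exact: leq_trans Nn h2.
exists ray; split=> // [N _|f f0 finfty].
  exact: (tail_rigid finS genS hyp pairs).
exact: (sparse_rigid finS genS hyp pairs f0 finfty rough ray0).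
Qed.
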